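(* Let $(\mathcal{Q},d)$ be a complete metric space with a dense subspace $\mathcal{R}$. Assume that there is a continuous mapping $f\mapsto\phi[f]$ from $(\mathcal{Q},d)$ to $(\mathcal{A}[\delta,M],d_{\mathcal{A}})$ such that $\phi[f]$ is a stable almost flow for any $f\in\mathcal{R}$. Then existence, uniqueness of D-solutions and convergence of numerical schemes are generic properties. More precisely: let $\mathcal{N}$ be the subset of those $(a,f)\in\mathcal{M}:=V\times\mathcal{Q}$ such that the numerical schemes $y^\pi\in\mathcal{C}(\mathbb{T},V)$ associated to $\phi[f]$ with $y^\pi_0=a$ converge uniformly, with respect to $\pi$, to some $y\in\mathcal{C}(\mathbb{T},V)$. Then $\mathcal{N}$ is a residual set in $V\times\mathcal{Q}$ and, for $(a,f)\in\mathcal{N}$, $y\in\mathcal{P}[\phi[f],a]$. In addition, the subset of those $(a,f)\in\mathcal{M}$ such that $\mathcal{P}[\phi[f],a]$ contains only one point is a residual set.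
   Context: Setting. $V$ is a Banach space with norm $|\cdot|$, $\mathfrak{i}$ is the identity map of $V$, $\mathcal{C}(V,V)$ is the set of continuous maps, $\|\cdot\|_\infty$ the sup norm, $\|f\|_{\mathrm{Lip}}=\sup_{a\ne b}|f(a)-f(b)|/|a-b|$. $T>0$, $\mathbb{T}=[0,T]$, $\mathbb{T}_+^2=\{(s,t)\in\mathbb{T}^2: s\le t\}$, $\mathbb{T}_+^3=\{(r,s,t)\in\mathbb{T}^3: r\le s\le t\}$. $\delta,\varpi:\mathbb{R}_+\to\mathbb{R}_+$ are non-decreasing with $\delta(0)=\varpi(0)=0$; $\delta_t:=\delta(t)$. $\omega:\mathbb{T}_+^2\to\mathbb{R}_+$ is a control: $\omega_{r,s}+\omega_{s,t}\le\omega_{r,t}$ on $\mathbb{T}_+^3$, $\omega_{s,s}=0$, and $\omega$ is continuous close to its diagonal. Standing assumptions: for some $\varkappa\in(0,1)$, $2\varpi(x/2)\le\varkappa\varpi(x)$ for all $x\ge0$; and $\varkappa+2\delta_T<1$. For $f:V\to V$, $\operatorname{osc}(f,h)=\sup_{|a-b|\le h}|f(a)-f(b)|$. A map $\chi:\mathbb{T}_+^2\to\mathcal{C}(V,V)$, $(s,t)\mapsto\chi_{t,s}$, is of class $\mathcal{O}$ if for some $C\ge0$: $\operatorname{osc}(\chi_{t,s},\lambda\varpi(\omega_{r,s}))\le C\delta_T(1+\lambda)\varpi(\omega_{r,t})$ for all $(r,s,t)\in\mathbb{T}_+^3$, $\lambda\ge0$; the smallest such $C$ is $\|\chi\|_{\mathcal{O}}$.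 $\mathcal{F}[\delta]$ is the class of families $\phi=\{\phi_{t,s}\}_{(s,t)\in\mathbb{T}_+^2}$ of maps $V\to V$ with $\phi_{t,s}=\mathfrak{i}+\widehat{\phi}_{t,s}$, $\widehat\phi$ of class $\mathcal{O}$, $\|\widehat\phi\|_{\mathcal{O}}\le1$ and $\|\widehat\phi_{t,s}\|_\infty\le\delta_{t-s}$ for all $(s,t)\in\mathbb{T}_+^2$. For $M\ge0$, $\mathcal{A}[\delta,M]$ is the set of $\phi\in\mathcal{F}[\delta]$ such that $\|\mathfrak{d}\phi_{t,s,r}\|_\infty\le M\varpi(\omega_{r,t})$ on $\mathbb{T}_+^3$, where $\mathfrak{d}\phi_{t,s,r}=\phi_{t,s}\circ\phi_{s,r}-\phi_{t,r}$ (almost flows). Stable almost flow: an almost flow $\phi\in\mathcal{A}[\delta,M]$ with $\|\phi_{t,s}-\mathfrak{i}\|_{\mathrm{Lip}}\le\delta_T$ such that $\sup_{(r,s,t)\in\mathbb{T}_+^3,\,r\ne t}\|\mathfrak{d}\phi_{t,s,r}\|_{\mathrm{Lip}}/\varpi(\omega_{r,t})<+\infty$, and satisfying the 4-points control: for all $(s,t)\in\mathbb{T}_+^2$ and $a,b,c,d\in V$, $$|\phi_{t,s}(a)-\phi_{t,s}(b)-\phi_{t,s}(c)+\phi_{t,s}(d)|\le\check{\phi}_{t,s}(|a-b|\vee|c-d|)\,(|a-c|\vee|b-d|)+(1+\delta_T)|a-b-c+d|,$$ where $\check\phi_{t,s}:\mathbb{R}_+\to\mathbb{R}_+$ and for any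 $\alpha\ge0$, $\check\phi_{t,s}(\alpha\varpi(\omega_{r,s}))\le\phi^\circledast(\alpha)\varpi(\omega_{r,t})$ for all $(r,s,t)\in\mathbb{T}_+^3$, with $\phi^\circledast(\alpha)\ge0$ depending on $\alpha$ and $\omega_{0,T}$. Distance: $d_{\mathcal{A}}(\phi,\psi)=\max\{d_\infty(\phi,\psi),\ \|\phi-\psi\|_{\mathcal{O}},\ \|\mathfrak{d}\phi-\mathfrak{d}\psi\|_{\infty\div\varpi}\}$, where $d_\infty(\phi,\psi)=\sup_{(s,t)\in\mathbb{T}_+^2}\|\phi_{t,s}-\psi_{t,s}\|_\infty$ and $\|\mathfrak{d}\phi-\mathfrak{d}\psi\|_{\infty\div\varpi}=\sup_{(r,s,t)\in\mathbb{T}_+^3,\,r\ne t}\|\mathfrak{d}\phi_{t,s,r}-\mathfrak{d}\psi_{t,s,r}\|_\infty/\varpi(\omega_{r,t})$. D-solutions: $\mathcal{P}[\phi,a]$ is the set of $y\in\mathcal{C}(\mathbb{T},V)$ with $y_0=a$ and, for some $K\ge0$, $|y_t-\phi_{t,s}(y_s)|\le K\varpi(\omega_{s,t})$ for all $(s,t)\in\mathbb{T}_+^2$. For a partition $\pi=\{t_i\}_{i=0}^n$ of $\mathbb{T}$ the numerical scheme of $\phi$ is $y^\pi_0=a$, $y^\pi_{t_{k+1}}=\phi_{t_{k+1},t_k}(y^\pi_{t_k})$, extended by linear interpolation to $\mathcal{C}(\mathbb{T},V)$. Convergence with respect to $\pi$ means convergence as $\operatorname{Mesh}\pi=\max_i(t_{i+1}-t_i)\to0$: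 for any $\epsilon>0$ there is $\pi$ such that the distance to the limit is at most $\epsilon$ for all $\sigma$ with $\operatorname{Mesh}\sigma\le\operatorname{Mesh}\pi$. A subset of a complete metric space is residual if its complement is of Baire first category; a property is generic if it is true on a residual set.
   Formalization: δ is additionally assumed to tend to 0 at 0+ (not only δ(0)=0); otherwise the claim fails, e.g. for φ_{t,s}(a)=a+(1_{t≥1/2}−1_{s≥1/2})/10 on V=ℝ, whose schemes never converge uniformly. *)

(* Defs.v *)
(* MathComp-Analysis world. *)
From HB Require Import structures.
From mathcomp Require Import all_boot all_order all_algebra.
From mathcomp Require Import all_classical all_reals all_analysis.

Set Implicit Arguments.
Unset Strict Implicit.
Unset Printing Implicit Defensive.

Import Order.TTheory GRing.Theory Num.Theory.
Import numFieldNormedType.Exports.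

Local Open Scope classical_set_scope.
Local Open Scope ring_scope.

Section category.
Context {X : topologicalType}.

Definition nowhere_dense (A : set X) : Prop := (closure A)° = set0.

Definition first_category (A : set X) : Prop :=
  exists2 F : (set X)^nat, (forall n, nowhere_dense (F n)) & A = \bigcup_n F n.

Definition residual (A : set X) : Prop := first_category (~` A).

End category.

(* The library's [completeType] is pointed; this form also allows an empty
   space. *)
Definition complete_space (X : uniformType) : Prop :=
  forall F : set_system X, ProperFilter F -> cauchy F -> exists x : X, F --> x.

Section norms.
Context {R : realType} {V : normedModType R}.
Local Open Scope ereal_scope.

Definition supnorm (f : V -> V) : \bar R := ereal_sup [set `|f a|%:E | a in setT].

Definition lipnorm (f : V -> V) : \bar R :=
  ereal_sup [set (`|f ab.1 - f ab.2| / `|ab.1 - ab.2|)%:E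
            | ab in [set ab : V * V | ab.1 != ab.2]].

Definition osc (f : V -> V) (h : R) : \bar R :=
  ereal_sup [set `|f ab.1 - f ab.2|%:E
            | ab in [set ab : V * V | (`|ab.1 - ab.2| <= h)%R]].

End norms.

Section almost_flows.
Context {R : realType} {V : normedModType R}.
(* [delta] and [varpi] stand for functions on R_+, and [omega s t] for a
   function on pairs s <= t of [0, T]; values elsewhere are irrelevant. *)
Variables (T : R) (delta varpi : R -> R) (omega : R -> R -> R).

Definition simplex2 (s t : R) : Prop := [/\ 0 <= s, s <= t & t <= T].

Definition simplex3 (r s t : R) : Prop :=
  [/\ 0 <= r, r <= s, s <= t & t <= T].

Record is_control : Prop := {
  control_ge0 : forall s t, simplex2 s t -> 0 <= omega s t;
  control_superadditive : forall r s t, simplex3 r s t ->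
    omega r s + omega s t <= omega r t;
  control_diag : forall s, simplex2 s s -> omega s s = 0;
  control_near_diag : forall e, 0 < e -> exists2 h, 0 < h &
    forall s t, simplex2 s t -> t <= s + h -> omega s t < e
}.

Record standing_assumptions (kappa : R) : Prop := {
  T_gt0 : 0 < T;
  delta_homo : forall x y, 0 <= x -> x <= y -> delta x <= delta y;
  delta0 : delta 0 = 0;
  (* delta(0) = 0 is understood as delta vanishing continuously at 0: otherwise
     an almost flow may jump at a fixed time, as does
     a |-> a + c (1_{t >= u} - 1_{s >= u}), and then no numerical scheme
     converges uniformly. *)
  delta_right0 : delta x @[x --> 0^'+] --> (0 : R);
  varpi_homo : forall x y, 0 <= x -> x <= y -> varpi x <= varpi y;
  varpi0 : varpi 0 = 0;
  omega_control : is_control;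
  kappa_gt0 : 0 < kappa;
  kappa_lt1 : kappa < 1;
  varpi_half : forall x, 0 <= x -> 2 * varpi (x / 2) <= kappa * varpi x;
  kappa_delta_lt1 : kappa + 2 * delta T < 1
}.

(* As in chi_{t,s}, the later time is the first argument of a family. *)
Implicit Types phi psi chi : R -> R -> V -> V.

Definition classO_bound chi (C : R) : Prop :=
  0 <= C /\
  forall r s t lambda, simplex3 r s t -> 0 <= lambda ->
    (osc (chi t s) (lambda * varpi (omega r s)) <=
       (C * delta T * (1 + lambda) * varpi (omega r t))%:E)%E.

Definition classO chi : Prop :=
  (forall s t, simplex2 s t -> continuous (chi t s)) /\
  exists C, classO_bound chi C.

Definition normO chi : \bar R := ereal_inf [set C%:E | C in classO_bound chi].

Definition hat phi : R -> R -> V -> V := fun t s a => phi t s a - a.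

Definition diff phi psi : R -> R -> V -> V := fun t s a => phi t s a - psi t s a.

Definition defect phi (t s r : R) : V -> V :=
  fun a => phi t s (phi s r a) - phi t r a.

Definition class_F phi : Prop :=
  [/\ classO (hat phi), (normO (hat phi) <= 1)%E &
      forall s t, simplex2 s t ->
        (supnorm (hat phi t s) <= (delta (t - s))%:E)%E].

Definition almost_flow (M : R) phi : Prop :=
  class_F phi /\
  forall r s t, simplex3 r s t ->
    (supnorm (defect phi t s r) <= (M * varpi (omega r t))%:E)%E.

(* In \bar R, 0 / 0 = 0 and x / 0 = +oo for x > 0: a supremum of such quotients
   is the least C such that the numerator is at most C times the
   denominator. *)
Definition sup_div_varpi (F : R -> R -> R -> \bar R) : \bar R :=
  ereal_sup [set (F x.1.1 x.1.2 x.2 / (varpi (omega x.1.1 x.2))%:E)%E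
            | x in [set x : R * R * R |
                     simplex3 x.1.1 x.1.2 x.2 /\ x.1.1 != x.2]].

Definition four_points_control phi : Prop :=
  exists (phi_check : R -> R -> R -> R) (phi_star : R -> R),
    [/\ forall s t x, simplex2 s t -> 0 <= x -> 0 <= phi_check t s x,
        forall alpha, 0 <= alpha -> 0 <= phi_star alpha,
        forall alpha r s t, 0 <= alpha -> simplex3 r s t ->
          phi_check t s (alpha * varpi (omega r s)) <=
            phi_star alpha * varpi (omega r t) &
        forall s t (a b c d : V), simplex2 s t ->
          `|phi t s a - phi t s b - phi t s c + phi t s d| <=
            phi_check t s (Num.max `|a - b| `|c - d|) *
              Num.max `|a - c| `|b - d|
            + (1 + delta T) * `|a - b - c + d|].

Record stable_almost_flow (M : R) phi : Prop := {
  stable_almost : almost_flow M phi;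
  stable_lip : forall s t, simplex2 s t ->
    (lipnorm (hat phi t s) <= (delta T)%:E)%E;
  stable_defect_lip :
    (sup_div_varpi (fun r s t => lipnorm (defect phi t s r)) < +oo)%E;
  stable_four_points : four_points_control phi
}.

Definition d_infty phi psi : \bar R :=
  ereal_sup [set supnorm (diff phi psi x.2 x.1)
            | x in [set x : R * R | simplex2 x.1 x.2]].

Definition d_defect phi psi : \bar R :=
  sup_div_varpi (fun r s t =>
    supnorm (fun a => defect phi t s r a - defect psi t s r a)).

Definition d_A phi psi : \bar R :=
  maxe (maxe (d_infty phi psi) (normO (diff phi psi))) (d_defect phi psi).

(* An element of C([0, T], V) is represented by y : R -> V that is continuous
   within [0, T]; its values outside [0, T] are irrelevant. *)
Definition D_solution phi (a : V) (y : R -> V) : Prop :=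
  [/\ {within `[0, T], continuous y}, y 0 = a &
      exists2 K, 0 <= K & forall s t, simplex2 s t ->
        `|y t - phi t s (y s)| <= K * varpi (omega s t)].

Definition unique_D_solution phi (a : V) : Prop :=
  exists2 y, D_solution phi a y &
    forall z, D_solution phi a z -> {in `[0, T], z =1 y}.

(* A partition t_0 < t_1 < ... < t_n is given by t_0 and p = [:: t_1; ...; t_n],
   as in [itv_partition]; [scheme phi t_0 a p] starts from a at time t_0 and is
   linearly interpolated between partition points. *)
Fixpoint scheme phi (s : R) (a : V) (p : seq R) (t : R) : V :=
  if p is s' :: p' then
    let a' := phi s' s a in
    if t <= s' then a + ((t - s) / (s' - s)) *: (a' - a)
    else scheme phi s' a' p' t
  else a.

Definition mesh (p : seq R) : R :=
  \big[Num.max/0]_(d <- pairmap (fun s t => t - s) 0 p) d.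

Definition schemes_converge phi (a : V) (y : R -> V) : Prop :=
  forall e, 0 < e -> exists2 p, itv_partition 0 T p &
    forall q, itv_partition 0 T q -> mesh q <= mesh p ->
      forall t, t \in `[0, T] -> `|scheme phi 0 a q t - y t| <= e.

End almost_flows.

(* Main.v *)
Require Import Defs.
From HB Require Import structures.
From mathcomp Require Import all_boot all_order all_algebra.
From mathcomp Require Import all_classical all_reals all_analysis.
From mathcomp Require Import zify ring lra.

Set Implicit Arguments.
Unset Strict Implicit.
Unset Printing Implicit Defensive.

Import Order.TTheory GRing.Theory Num.Theory.
Import numFieldNormedType.Exports.

Local Open Scope classical_set_scope.
Local Open Scope ring_scope.

(** For each tolerance [e], consider the pairs [(a, f)] such that all schemes of
    [phi f] from [a] on fine enough partitions lie within [e] of one another, and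
    such that any two D-solutions lie within [e] of one another.  Pairs
    satisfying this for all [e] have converging schemes and exactly one
    D-solution (the limit of the schemes).  When [phi f] is stable the condition
    at [e] holds on a whole neighbourhood of [(a, f)], for every [a]; since the
    stable [f] are dense, the condition contains a dense open set, and a
    sequence of tolerances going to [0] gives the residual sets
    ([residual_bigcap]).

    The neighbourhood comes from [stability]: if [phi] is stable, [psi] is
    [eps]-close to it, [y] and [z] are a trajectory of each, then
    [|y - z| <= C (|y_0 - z_0| + eps)].  One measures the gap
    [W r t = (y t - phi t r (y r)) - (z t - psi t r (z r))].  Going from [r] to
    [t] through [s], the 4-points control and the Lipschitz bound on the defect
    give [|W r t| <= |W s t| + (1 + delta T) |W r s| + O(D + eps) varpi(omega r t)],
    where [D] bounds [|y - z|].  Davie's choice of [s] halves the control on both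
    sides, so that [2 varpi (x / 2) <= kappa varpi x] makes the recursion
    contract: [|W r t| = O(D + eps) varpi(omega r t)] ([gap_window]).  On a short
    window this is absorbed into [D] ([window_bound]), and finitely many windows
    cover [0, T].  The same argument without differences shows that schemes and
    D-solutions satisfy [|y t - phi t s (y s)| <= L varpi(omega s t)] with [L]
    depending on the class of almost flows only ([scheme_approx_solution],
    [D_solution_approx]); this uniform [L] is what allows [stability] to be
    applied to trajectories of a nearby [psi] that need not be stable.  It is
    applied on two time sets, the points of a partition (schemes) and [0, T]
    (D-solutions).

    Schemes of a stable flow converge: on the points of a partition, the scheme
    of a refinement is a trajectory up to one-step errors [L varpi(omega)]; the
    flow being Lipschitz by [stability] with [psi = phi], these errors add up
    ([scheme_telescope]) and their sum vanishes with the mesh because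
    [varpi x = o(x)] ([varpi_small]).

    The 4-points control bounds differences at scale [alpha varpi(omega r s)] by
    a quantity that depends on [alpha] in an arbitrary way, whereas the argument
    meets all [alpha <= L] at once.  [four_points_uniform] supplies the missing
    uniformity with Baire's theorem on the line. *)

(** * Geometric bounds and residual sets *)

Section self_improvement.
Context {R : realType}.
Implicit Types rho c e : R.

Lemma geometric_small rho c e : 0 <= rho -> rho < 1 -> 0 < e ->
  exists n, rho ^+ n * c <= e.
Proof.
move=> rho0 rho1 e0.
have cv : (fun n => rho ^+ n * c) @ \oo --> (0 : R).
  rewrite -[X in _ --> X](mul0r c); apply: cvgMl.
  by apply: cvg_expr; rewrite ger0_norm.
move/cvgr_le : cv => /(_ _ e0)[n _ nP].
by exists n; apply: nP => /=.
Qed.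

(** Replaces taking the supremum of the ratios [u / v]: iterating the improvement
    from any a priori bound reaches the fixed point of [K |-> rho * K + c]. *)
Lemma self_improving_bound (I : Type) (P : I -> Prop) (u v : I -> R)
    rho c (K0 : R) :
  0 <= rho -> rho < 1 -> 0 <= c -> 0 <= K0 ->
  (forall i, P i -> 0 <= v i) ->
  (forall i, P i -> u i <= K0 * v i) ->
  (forall K, 0 <= K -> (forall i, P i -> u i <= K * v i) ->
    forall i, P i -> u i <= (rho * K + c) * v i) ->
  forall i, P i -> u i <= c / (1 - rho) * v i.
Proof.
move=> rho0 rho1 c0 K00 v0 uK0 step i Pi.
have rhoV : 0 < 1 - rho by rewrite subr_gt0.
have fix_ge0 : 0 <= c / (1 - rho) by apply: divr_ge0 => //; apply: ltW.
have iterate n : forall j, P j -> u j <= (c / (1 - rho) + rho ^+ n * K0) * v j.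
  elim: n => [|n IHn] j Pj.
    rewrite expr0 mul1r mulrDl; apply: le_trans (uK0 _ Pj) _.
    by rewrite lerDr mulr_ge0 // v0.
  have -> : c / (1 - rho) + rho ^+ n.+1 * K0 =
            rho * (c / (1 - rho) + rho ^+ n * K0) + c.
    by rewrite exprS; field; lra.
  apply: step => //; apply: addr_ge0 => //; apply: mulr_ge0 => //.
  exact: exprn_ge0.
apply/ler_addgt0Pr => e e0.
have [n small] := geometric_small (K0 * v i) rho0 rho1 e0.
apply: le_trans (iterate n _ Pi) _.
by rewrite mulrDl lerD2l -mulrA.
Qed.

Lemma null_sequence : exists tol : nat -> R, [/\ forall n, 0 < tol n,
  forall m n, (m <= n)%N -> tol n <= tol m &
  forall e, 0 < e -> exists n, tol n <= e].
Proof.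
exists (fun n => n.+1%:R^-1); split=> [n|m n mn|e e0].
- by rewrite invr_gt0.
- by rewrite lef_pV2 ?posrE // ler_nat ltnS.
- exists (Num.truncn e^-1).
  by rewrite -[leRHS]invrK lef_pV2 ?posrE ?invr_gt0 // ltW // truncnS_gt.
Qed.

End self_improvement.

(** The exceptional set is covered by the complements of the [G n], whose
    closures have empty interior; the decomposition must be an equality, so these
    complements are intersected with that of [A]. *)
Lemma residual_bigcap {X : topologicalType} (G : (set X)^nat) (A : set X) :
  (forall n, dense (G n)°) -> (\bigcap_n G n) `<=` A -> residual A.
Proof.
move=> Gdense GA; exists (fun n => ~` A `&` ~` G n); last first.
  rewrite -setI_bigcupr -setC_bigcap; apply/seteqP; split=> [x nAx|x []//].
  by split=> // /GA.
move=> n; rewrite /nowhere_dense -subset0 => x.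
set O := (closure (~` A `&` ~` G n))° => Ox.
have [y [Oy Gy]] := Gdense n O (ex_intro _ x Ox) (open_interior _).
have /= := interior_subset Oy.
move=> /(_ (G n)) [|z [[_ /= nGz] Gz]]; last by [].
by [].
Qed.

(** * The control and the function varpi *)

Section control.
Context {R : realType} (T : R) (delta varpi : R -> R) (omega : R -> R -> R).
Context (kappa : R).
Hypothesis Hstd : standing_assumptions T delta varpi omega kappa.

Lemma delta_ge0 x : 0 <= x -> 0 <= delta x.
Proof. by move=> x0; rewrite -(delta0 Hstd); apply: (delta_homo Hstd). Qed.

Lemma varpi_ge0 x : 0 <= x -> 0 <= varpi x.
Proof. by move=> x0; rewrite -(varpi0 Hstd); apply: (varpi_homo Hstd). Qed.

Lemma deltaT_ge0 : 0 <= delta T.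
Proof. by apply: delta_ge0; apply/ltW/(T_gt0 Hstd). Qed.

Lemma simplex3_12 r s t : simplex3 T r s t -> simplex2 T r s.
Proof. by case=> *; split=> //; lra. Qed.

Lemma simplex3_23 r s t : simplex3 T r s t -> simplex2 T s t.
Proof. by case=> *; split=> //; lra. Qed.

Lemma simplex3_13 r s t : simplex3 T r s t -> simplex2 T r t.
Proof. by case=> *; split=> //; lra. Qed.

Lemma varpi_omega_ge0 s t : simplex2 T s t -> 0 <= varpi (omega s t).
Proof.
by move=> st; apply/varpi_ge0/(control_ge0 (omega_control Hstd)).
Qed.

Lemma omega_le_left r s t : simplex3 T r s t -> omega r s <= omega r t.
Proof.
move=> rst; have := control_superadditive (omega_control Hstd) rst.
have := control_ge0 (omega_control Hstd) (simplex3_23 rst); lra.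
Qed.

Lemma omega_le_right r s t : simplex3 T r s t -> omega s t <= omega r t.
Proof.
move=> rst; have := control_superadditive (omega_control Hstd) rst.
have := control_ge0 (omega_control Hstd) (simplex3_12 rst); lra.
Qed.

Lemma varpi_omega_left r s t : simplex3 T r s t ->
  varpi (omega r s) <= varpi (omega r t).
Proof.
move=> rst; apply: (varpi_homo Hstd); last exact: omega_le_left.
exact/(control_ge0 (omega_control Hstd))/(simplex3_12 rst).
Qed.

Lemma varpi_omega_right r s t : simplex3 T r s t ->
  varpi (omega s t) <= varpi (omega r t).
Proof.
move=> rst; apply: (varpi_homo Hstd); last exact: omega_le_right.
exact/(control_ge0 (omega_control Hstd))/(simplex3_23 rst).
Qed.

Lemma varpi_omega_half r s t u : simplex2 T r s -> simplex2 T t u ->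
  omega r s <= omega t u / 2 ->
  varpi (omega r s) <= kappa / 2 * varpi (omega t u).
Proof.
move=> rs tu half.
have w0 := control_ge0 (omega_control Hstd) rs.
have := varpi_homo Hstd w0 half.
have := varpi_half Hstd (control_ge0 (omega_control Hstd) tu).
lra.
Qed.

Lemma varpi_pow n x : 0 <= x -> 2 ^+ n * varpi (x / 2 ^+ n) <= kappa ^+ n * varpi x.
Proof.
move=> x0; elim: n => [|n IHn]; first by rewrite !expr0 divr1.
have p0 : 0 < (2 : R) ^+ n by rewrite exprn_gt0.
have y0 : 0 <= x / 2 ^+ n by rewrite divr_ge0 // ltW.
have half := varpi_half Hstd y0.
have -> : x / 2 ^+ n.+1 = x / 2 ^+ n / 2.
  by rewrite exprS; field; rewrite gt_eqF.
rewrite 2!exprS -mulrA [X in X <= _]mulrCA.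
apply: le_trans (ler_wpM2l (ltW p0) half) _.
rewrite mulrCA -mulrA.
by apply: ler_wpM2l => //; apply/ltW/(kappa_gt0 Hstd).
Qed.

(** [varpi x = o(x)] at [0]: each halving of [x] multiplies the quotient
    [varpi x / x] by at most [kappa < 1]. *)
Lemma varpi_small e : 0 < e ->
  exists2 x1, 0 < x1 & forall x, 0 <= x -> x <= x1 -> varpi x <= e * x.
Proof.
move=> e0.
have [n small] := geometric_small (varpi 1) (ltW (kappa_gt0 Hstd))
  (kappa_lt1 Hstd) (divr_gt0 e0 (ltr0n _ 2)).
have p0 : 0 < (2 : R) ^+ n by rewrite exprn_gt0.
exists (2 ^+ n)^-1; first by rewrite invr_gt0.
set x1 := _^-1; have x10 : 0 < x1 by rewrite invr_gt0.
have top : varpi x1 <= e / 2 * x1.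
  have := le_trans (varpi_pow n ler01) small.
  by rewrite mul1r mulrC -ler_pdivlMr.
(* Induction over the dyadic scales below [x1]: double [x] until it exceeds
   [x1 / 2], where monotonicity and [top] conclude. *)
have scale k : forall x, x1 / 2 ^+ k < x -> x <= x1 -> varpi x <= e * x.
  elim: k => [|k IHk] x xk xx1; first by rewrite expr0 divr1 in xk; lra.
  have xpos : 0 < x.
    by apply: le_lt_trans xk; rewrite divr_ge0 // ltW // exprn_gt0.
  have [big|small2] := ltP x1 (2 * x).
    have := varpi_homo Hstd (ltW xpos) xx1.
    have : e / 2 * x1 <= e / 2 * (2 * x) by rewrite ler_wpM2l // ?ltW //; lra.
    lra.
  have x2k : x1 / 2 ^+ k < 2 * x.
    move: xk; rewrite exprS invfM mulrCA; lra.
  have hyp := IHk _ x2k small2.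
  have := varpi_half Hstd (ltW (mulr_gt0 (ltr0n R 2) xpos)).
  rewrite (_ : 2 * x / 2 = x); last by lra.
  have : kappa * varpi (2 * x) <= 1 * varpi (2 * x).
    apply: ler_wpM2r; first by apply: varpi_ge0; lra.
    exact/ltW/(kappa_lt1 Hstd).
  lra.
move=> x; rewrite le_eqVlt => /orP[/eqP<- _|xpos xx1].
  by rewrite (varpi0 Hstd) mulr0.
have half0 : 0 <= (2 : R)^-1 by rewrite invr_ge0.
have half1 : (2 : R)^-1 < 1 by rewrite invf_lt1 //; lra.
have [k kP] := geometric_small x1 half0 half1 (divr_gt0 xpos (ltr0n _ 2)).
apply: (scale k) => //.
rewrite mulrC -exprVn; lra.
Qed.

Lemma varpi_omega_small e : 0 < e -> exists2 h, 0 < h &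
  forall s t, simplex2 T s t -> t <= s + h ->
    varpi (omega s t) <= e * omega s t /\ varpi (omega s t) <= e.
Proof.
move=> e0; have [x1 x10 small] := varpi_small e0.
have m0 : 0 < Num.min x1 1 by rewrite lt_min x10 ltr01.
have [h h0 hP] := control_near_diag (omega_control Hstd) m0.
exists h => // s t st tsh; have := hP _ _ st tsh.
rewrite lt_min => /andP[wx1 w1].
have w0 := control_ge0 (omega_control Hstd) st.
have le1 := small _ w0 (ltW wx1); split=> //.
apply: le_trans le1 _; rewrite -[leRHS]mulr1; apply: ler_wpM2l => //; exact: ltW.
Qed.

Lemma delta_small e : 0 < e ->
  exists2 h, 0 < h & forall x, 0 <= x -> x <= h -> delta x <= e.
Proof.
move=> e0; have /cvgr_le/(_ _ e0) := delta_right0 Hstd.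
rewrite near_withinE => -[d /= d0 dP].
exists (d / 2); first by rewrite divr_gt0.
move=> x x0 xd; apply: le_trans (delta_homo Hstd x0 xd) _.
apply: dP; rewrite /= ?divr_gt0 // sub0r normrN ger0_norm; first by rewrite ltr_pdivrMr //; lra.
by rewrite divr_ge0 // ltW.
Qed.

(** Davie's splitting: [k] is the last index for which the control on
    [tt i, tt k] is at most half of the total, so that superadditivity leaves at
    most the other half to [tt k.+1, tt j]. *)
Lemma control_split (tt : nat -> R) i j :
  (forall k, 0 <= tt k <= T) -> (forall k, tt k <= tt k.+1) -> (i < j)%N ->
  exists k, [/\ (i <= k)%N, (k < j)%N,
    omega (tt i) (tt k) <= omega (tt i) (tt j) / 2 &
    omega (tt k.+1) (tt j) <= omega (tt i) (tt j) / 2].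
Proof.
move=> tt0T ttS ij.
have mono : {homo tt : a b / (a <= b)%N >-> a <= b}.
  exact: homo_leq le_refl le_trans ttS.
have simp3 a b c : (a <= b)%N -> (b <= c)%N -> simplex3 T (tt a) (tt b) (tt c).
  by move=> ab bc; split; rewrite ?mono //; case/andP: (tt0T a); case/andP: (tt0T c).
have simp2 a b : (a <= b)%N -> simplex2 T (tt a) (tt b).
  by move=> ab; apply: simplex3_13 (simp3 a b b ab _).
have diag : omega (tt i) (tt i) = 0.
  exact/(control_diag (omega_control Hstd))/simp2.
set W := omega (tt i) (tt j).
have W0 : 0 <= W by apply/(control_ge0 (omega_control Hstd))/simp2/ltnW.
have [Wle|Wpos] := leP W 0.
  exists i; split; rewrite ?leqnn // ?diag; first lra.
  by have := omega_le_right (simp3 i i.+1 j (leqnSn _) ij); rewrite -/W; lra.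
have cross m : (i <= m)%N -> W / 2 < omega (tt i) (tt m) ->
    exists k, [/\ (i <= k)%N, (k < m)%N, omega (tt i) (tt k) <= W / 2 &
      W / 2 < omega (tt i) (tt k.+1)].
  elim: m => [|m IHm].
    by rewrite leqn0 => /eqP i0; move: diag; rewrite i0 => ->; lra.
  rewrite leq_eqVlt => /orP[/eqP <-|]; first by rewrite diag; lra.
  rewrite ltnS => im big.
  have [small|big'] := leP (omega (tt i) (tt m)) (W / 2).
    by exists m.
  have [k [ik km lo hi]] := IHm im big'.
  by exists k; split=> //; apply: ltnW.
have [|k [ik kj lo hi]] := cross j (ltnW ij); first by rewrite -/W; lra.
exists k; split=> //.
have := control_superadditive (omega_control Hstd) (simp3 i k.+1 j (leqW ik) kj).
rewrite -/W; lra.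
Qed.

End control.

(** * Partitions and numerical schemes *)

Section partitions.
Context {R : realType}.
Implicit Types (h a b s t : R) (p : seq R).

(** [mesh p <= h] as a path condition, which restricts to tails of a partition. *)
Definition steps_le h a p := path (fun s t => t - s <= h) a p.

Lemma mesh_le h p : 0 <= h -> (mesh p <= h) = steps_le h 0 p.
Proof.
rewrite /mesh /steps_le; move=> h0.
suff gen s : (\big[Num.max/0]_(d <- pairmap (fun s t => t - s) s p) d <= h) =
    path (fun s t => t - s <= h) s p by apply: gen.
elim: p s => [|t p IHp] s /=; first by rewrite big_nil.
by rewrite big_cons ge_max IHp.
Qed.

Lemma exists_fine_partition h a b : 0 < h -> a < b ->
  exists2 p, itv_partition a b p & steps_le h a p.
Proof.
move=> h0; have [n] : exists n, b - a <= n%:R * h.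
  exists (Num.truncn ((b - a) / h)).+1.
  by rewrite -ler_pdivrMr // ltW // truncnS_gt.
elim: n a => [|n IHn] a le_n ab; first by rewrite mul0r in le_n; lra.
have [small|big] := leP (b - a) h.
  by exists [:: b]; rewrite /itv_partition /steps_le /= ?ab ?small.
have [||p [pa pb] ph] := IHn (a + h); [|lra|].
  by move: le_n; rewrite -natr1 mulrDl mul1r; lra.
exists (a + h :: p); rewrite /itv_partition /steps_le /= ?ltrDl ?h0 //.
by rewrite [_ + h - a]addrAC subrr add0r lexx.
Qed.

Lemma steps_le_cat h a b p q : itv_partition a b p ->
  steps_le h a p -> steps_le h b q -> steps_le h a (p ++ q).
Proof. by move=> [_ /eqP pb] ap bq; rewrite /steps_le cat_path pb; apply/andP. Qed.

Section grid.
Context (a b : R) (p : seq R).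
Hypothesis abp : itv_partition a b p.

Lemma partition_sorted : sorted <%R (a :: p).
Proof. by case: abp. Qed.

Lemma grid_last : nth b (a :: p) (size p) = b.
Proof. by case: abp => _ /eqP; rewrite (last_nth b). Qed.

Lemma grid_lt i j : (i < j <= size p)%N -> nth b (a :: p) i < nth b (a :: p) j.
Proof.
move=> /andP[ij jp]; rewrite (@sorted_ltn_nth _ _ _ _ _ partition_sorted) //.
- exact: lt_trans.
- by rewrite inE ltnS; apply/ltnW/(leq_trans ij).
Qed.

Lemma grid_nondecreasing k : nth b (a :: p) k <= nth b (a :: p) k.+1.
Proof.
have [kp|pk] := ltnP k (size p); first by apply/ltW/grid_lt; rewrite ltnSn.
rewrite [leRHS]nth_default //.
move: pk; rewrite leq_eqVlt => /orP[/eqP<-|pk]; first by rewrite grid_last.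
by rewrite nth_default.
Qed.

Lemma grid_bounds k : a <= nth b (a :: p) k <= b.
Proof.
have mono : {homo nth b (a :: p) : i j / (i <= j)%N >-> i <= j}.
  exact: homo_leq le_refl le_trans grid_nondecreasing.
apply/andP; split; first exact: (mono 0%N).
have [kp|pk] := leqP k (size p); first by rewrite -[leRHS]grid_last; apply: mono.
by rewrite nth_default.
Qed.

Lemma grid_index t : t \in a :: p ->
  exists2 k, (k <= size p)%N & nth b (a :: p) k = t.
Proof.
by move=> tp; exists (index t (a :: p)); rewrite ?nth_index // -ltnS index_mem.
Qed.

Lemma mem_grid_bounds t : t \in a :: p -> a <= t <= b.
Proof. by case/grid_index => k _ <-; apply: grid_bounds. Qed.

End grid.

Lemma itv_partition_head_tail a b s p : itv_partition a b (s :: p) ->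
  a < s /\ itv_partition s b p.
Proof. by case=> /= /andP[]. Qed.

Context {V : normedModType R}.
Implicit Types (phi : R -> R -> V -> V) (x : V).

Lemma scheme_start phi a b x p : itv_partition a b p -> scheme phi a x p a = x.
Proof.
case: p => //= s p /itv_partition_head_tail[as_ _].
by rewrite ltW // subrr mul0r scale0r addr0.
Qed.

Lemma scheme_cons phi a b x s p t : itv_partition a b (s :: p) -> s <= t ->
  scheme phi a x (s :: p) t = scheme phi s (phi s a x) p t.
Proof.
move=> /itv_partition_head_tail[as_ sp] st /=; case: ifP => // ts.
have -> : t = s by apply: le_anti; rewrite ts st.
rewrite divff ?scale1r ?subr_eq0 ?gt_eqF //.
by rewrite (scheme_start _ _ sp) addrC subrK.
Qed.

Lemma scheme_step phi a b x p k : itv_partition a b p -> (k < size p)%N ->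
  scheme phi a x p (nth b (a :: p) k.+1) =
  phi (nth b (a :: p) k.+1) (nth b (a :: p) k)
    (scheme phi a x p (nth b (a :: p) k)).
Proof.
elim: p a x k => // s p IHp a x k abp kp.
have [as_ sp] := itv_partition_head_tail abp.
have next j : scheme phi a x (s :: p) (nth b (s :: p) j) =
    scheme phi s (phi s a x) p (nth b (s :: p) j).
  by apply: (scheme_cons _ _ abp); case/andP: (grid_bounds sp j).
case: k kp => [|k] kp.
  by rewrite [LHS](next 0%N) [nth _ _ 1]/= [nth _ _ 0]/= (scheme_start _ _ sp)
    (scheme_start _ _ abp).
by rewrite [LHS](next k.+1) [in RHS](next k); apply: IHp.
Qed.

(** The partition point [s] is the last one before [t] and does not depend on
    the flow, so that two schemes on the same partition are interpolated from the
    same point. *)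
Lemma scheme_interpolation a b p h e t : itv_partition a b p ->
  steps_le h a p -> a <= t <= b -> 0 <= h -> 0 <= e ->
  exists s, [/\ s \in a :: p, s <= t, t - s <= h &
    forall phi x,
      (forall s s' y, a <= s -> s <= s' -> s' <= b -> s' - s <= h ->
        `|phi s' s y - y| <= e) ->
      `|scheme phi a x p t - scheme phi a x p s| <= e].
Proof.
move=> + + + h0 e0; elim: p a => [|s p IHp] a abp hp /andP[at_ tb].
  exists a; rewrite inE eqxx; split=> // [|phi x _]; last by rewrite subrr normr0.
  by case: abp => /= _ /eqP ->; lra.
have [as_ sp] := itv_partition_head_tail abp.
have [sa hp'] := andP hp.
have sb := itv_partition_le sp.
have [ts|st] := ltP t s.
  exists a; split; rewrite ?mem_head //; first by lra.
  move=> phi x small.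
  rewrite (scheme_start _ _ abp) /= (ltW ts) [x + _]addrC addrK normrZ.
  rewrite -[leRHS]mul1r; apply: ler_pM => //; last by apply: small; lra.
  rewrite ger0_norm ?ler_pdivrMr ?divr_ge0 //; lra.
have [|r [rp rt tr close]] := IHp s sp hp'; first by rewrite st.
exists r; split=> //; first by rewrite inE rp orbT.
move=> phi x small; have sr : s <= r by case/andP: (mem_grid_bounds sp rp).
rewrite !(scheme_cons _ _ abp) //; apply: close => s1 s2 y ss1 s1s2 s2b.
by apply: small => //; lra.
Qed.

End partitions.

Section refinement.
Context {R : realType}.
Implicit Types (h a b s t : R) (p q : seq R).

Definition refinement p q := sort <=%R (undup (p ++ q)).

Lemma mem_refinement a p q s : s \in a :: p \/ s \in a :: q -> s \in a :: refinement p q.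
Proof.
rewrite !inE mem_sort mem_undup mem_cat.
by case=> /orP[->//|->]; rewrite ?orbT.
Qed.

Lemma refinement_partition a b p q : itv_partition a b p -> itv_partition a b q ->
  itv_partition a b (refinement p q).
Proof.
move=> abp abq.
have gt_a s : s \in refinement p q -> a < s.
  rewrite mem_sort mem_undup mem_cat => /orP[] sp.
    by case: abp => /(order_path_min lt_trans)/allP/(_ _ sp).
  by case: abq => /(order_path_min lt_trans)/allP/(_ _ sp).
have le_b s : s \in a :: refinement p q -> s <= b.
  rewrite inE => /orP[/eqP ->|]; first exact: itv_partition_le abp.
  rewrite mem_sort mem_undup mem_cat => /orP[] sp.
    by have /andP[] := mem_grid_bounds abp (predU1r _ _ sp).
  by have /andP[] := mem_grid_bounds abq (predU1r _ _ sp).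
have sorted_r : path <%R a (refinement p q).
  rewrite path_sortedE; last exact: lt_trans.
  apply/andP; split; first by apply/allP => s /gt_a.
  by rewrite sort_lt_sorted undup_uniq.
split=> //; apply/eqP/le_anti; rewrite le_b ?mem_last //=.
have b_in : b \in a :: refinement p q.
  apply: mem_refinement; left; case: abp => _ /eqP <-; exact: mem_last.
have to_last : itv_partition a (last a (refinement p q)) (refinement p q) by split.
by case/andP: (mem_grid_bounds to_last b_in).
Qed.

End refinement.

Section fine_partitions.
Context {R : realType}.
Implicit Types (h a b s t : R) (p q : seq R).

Lemma mesh_gt0 T p : 0 < T -> itv_partition 0 T p -> 0 < mesh p.
Proof.
case: p => [|s p] T0 pT; first by case: pT => _ /eqP /= T_eq0; lra.
have [s0 _] := itv_partition_head_tail pT.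
rewrite ltNge; apply/negP; rewrite mesh_le // => /andP[/= s_le _]; lra.
Qed.

Lemma exists_fine_partition_le h a b : 0 < h -> a <= b ->
  exists2 p, itv_partition a b p & steps_le h a p.
Proof.
move=> h0; rewrite le_eqVlt => /orP[/eqP <-|]; last exact: exists_fine_partition.
by exists [::] => //; split=> /=.
Qed.

(** Lets the defining inequality of a D-solution, which concerns two arbitrary
    times, be read off schemes. *)
Lemma exists_fine_partition_through h s t T : 0 < h -> 0 <= s -> s <= t -> t <= T ->
  exists p, [/\ itv_partition 0 T p, steps_le h 0 p, s \in 0 :: p & t \in 0 :: p].
Proof.
move=> h0 s0 st tT.
have [p1 p1P p1h] := exists_fine_partition_le h0 s0.
have [p2 p2P p2h] := exists_fine_partition_le h0 st.
have [p3 p3P p3h] := exists_fine_partition_le h0 tT.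
have p12 := itv_partition_cat p1P p2P.
exists ((p1 ++ p2) ++ p3); split.
- exact: itv_partition_cat p12 p3P.
- by apply: (steps_le_cat p12) => //; exact: steps_le_cat p1P p1h p2h.
- have : s \in 0 :: p1 by case: p1P => _ /eqP <-; exact: mem_last.
  by move=> sp; rewrite -catA -cat_cons mem_cat sp.
- have : t \in 0 :: p1 ++ p2 by case: p12 => _ /eqP <-; exact: mem_last.
  by move=> tp; rewrite -cat_cons mem_cat tp.
Qed.

End fine_partitions.

(** * Pointwise bounds for almost flows *)

Section pointwise.
Context {R : realType} {V : normedModType R}.
Implicit Types (f : V -> V) (x y : V).

Lemma supnorm_bound f e x : (supnorm f <= e%:E)%E -> `|f x| <= e.
Proof.
move=> fe; rewrite -lee_fin; apply: le_trans fe.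
by apply: ereal_sup_ubound; exists x.
Qed.

Lemma lipnorm_bound f e x y : (lipnorm f <= e%:E)%E ->
  `|f x - f y| <= e * `|x - y|.
Proof.
move=> fe; have [<-|xy] := eqVneq x y; first by rewrite !subrr normr0 mulr0.
rewrite -ler_pdivrMr ?normr_gt0 ?subr_eq0 // -lee_fin; apply: le_trans fe.
by apply: ereal_sup_ubound; exists (x, y).
Qed.

Lemma osc_bound f h e x y : (osc f h <= e%:E)%E -> `|x - y| <= h ->
  `|f x - f y| <= e.
Proof.
move=> fe xy; rewrite -lee_fin; apply: le_trans fe.
by apply: ereal_sup_ubound; exists (x, y).
Qed.

Context (T : R) (delta varpi : R -> R) (omega : R -> R -> R) (kappa : R).
Hypothesis Hstd : standing_assumptions T delta varpi omega kappa.
Implicit Types (phi psi chi : R -> R -> V -> V).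

(** The infimum defining [normO] is attained. *)
Lemma normO_bound chi C r s t lambda x y : (normO T delta varpi omega chi <= C%:E)%E ->
  simplex3 T r s t -> 0 <= lambda ->
  `|x - y| <= lambda * varpi (omega r s) ->
  `|chi t s x - chi t s y| <= C * delta T * (1 + lambda) * varpi (omega r t).
Proof.
move=> chiC rst l0 xy.
set Z := delta T * (1 + lambda) * varpi (omega r t).
have Z0 : 0 <= Z.
  rewrite !mulr_ge0 ?(deltaT_ge0 Hstd) ?(varpi_omega_ge0 Hstd (simplex3_13 rst)) //.
  lra.
rewrite -!mulrA -[_ * (_ * _)]/(C * (_ * _)) [delta T * _]mulrA -/Z.
apply/ler_addgt0Pr => e e0.
have e'0 : 0 < e / (1 + Z) by rewrite divr_gt0 //; lra.
have : (normO T delta varpi omega chi < (C + e / (1 + Z))%:E)%E.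
  by apply: le_lt_trans chiC _; rewrite lte_fin; lra.
move=> /ereal_inf_lt[_ [C' [C'0 chiC'] <-]]; rewrite lte_fin => C'lt.
have := osc_bound (chiC' _ _ _ _ rst l0) xy.
rewrite -!mulrA [delta T * _]mulrA -/Z => /le_trans; apply.
apply: (@le_trans _ _ ((C + e / (1 + Z)) * Z)).
  by apply: ler_wpM2r => //; apply: ltW.
rewrite mulrDl lerD2l mulrAC ler_pdivrMr; last by lra.
by rewrite ler_pM2l //; lra.
Qed.

(** When [varpi (omega r t) = 0], a finite supremum forces [F r s t <= 0], by the
    conventions on [0^-1] in the extended reals. *)
Lemma sup_div_varpi_bound F C r s t v :
  (sup_div_varpi T varpi omega F <= C%:E)%E ->
  simplex3 T r s t -> r != t -> 0 <= v -> (v%:E <= F r s t)%E ->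
  v <= C * varpi (omega r t).
Proof.
move=> FC rst rt v0 vF.
have w0 := varpi_omega_ge0 Hstd (simplex3_13 rst).
have {FC} : (F r s t / (varpi (omega r t))%:E <= C%:E)%E.
  apply: le_trans FC; apply: ereal_sup_ubound.
  by exists (r, s, t).
move: w0; rewrite le_eqVlt => /orP[/eqP<-|w0]; last first.
  by rewrite inver gt_eqF // lee_pdivrMr // => /(le_trans vF); rewrite -EFinM lee_fin.
move: v0; rewrite le_eqVlt => /orP[/eqP<-|v0]; first by rewrite mulr0.
have F0 : (0 < F r s t)%E by apply: lt_le_trans vF; rewrite lte_fin.
by rewrite inve0 gt0_muley // leye_eq.
Qed.

Section almost_flow_bounds.
Context (M : R) (phi : R -> R -> V -> V).
Hypothesis phiM : almost_flow T delta varpi omega M phi.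

Lemma almost_flow_displacement s t x : simplex2 T s t ->
  `|phi t s x - x| <= delta (t - s).
Proof. by case: phiM => -[_ _ b] _ st; exact: supnorm_bound (b _ _ st). Qed.

Lemma almost_flow_diag s x : simplex2 T s s -> phi s s x = x.
Proof.
move=> ss; have := almost_flow_displacement x ss.
by rewrite subrr (delta0 Hstd) normr_le0 subr_eq0 => /eqP.
Qed.

Lemma almost_flow_osc r s t lambda x y : simplex3 T r s t -> 0 <= lambda ->
  `|x - y| <= lambda * varpi (omega r s) ->
  `|phi t s x - phi t s y| <=
    `|x - y| + delta T * (1 + lambda) * varpi (omega r t).
Proof.
case: phiM => -[_ O _] _ rst l0 xy.
have := normO_bound O rst l0 xy; rewrite mul1r /hat => hatxy.
have -> : phi t s x - phi t s y = (x - y) + (phi t s x - x - (phi t s y - y)).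
  by rewrite opprB addrACA [x + _]addrC subrK addKr.
by apply: le_trans (ler_normD _ _) _; rewrite lerD2l.
Qed.

Lemma almost_flow_defect r s t x : simplex3 T r s t ->
  `|phi t s (phi s r x) - phi t r x| <= M * varpi (omega r t).
Proof. by case: phiM => _ d rst; exact: supnorm_bound (d _ _ _ rst). Qed.

Lemma almost_flow_continuous s t : simplex2 T s t -> continuous (phi t s).
Proof.
case: phiM => -[[c _] _ _] _ st x.
have -> : phi t s = fun x => hat phi t s x + x.
  by apply/funext => y; rewrite /hat subrK.
by apply: cvgD; [exact: c | exact: cvg_id].
Qed.

End almost_flow_bounds.

(** The pointwise content of [d_A phi psi <= eps]. *)
Record flow_close eps phi psi : Prop := {
  close_ge0 : 0 <= eps;
  close_sup : forall s t x, simplex2 T s t -> `|phi t s x - psi t s x| <= eps;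
  close_osc : forall r s t lambda x y, simplex3 T r s t -> 0 <= lambda ->
    `|x - y| <= lambda * varpi (omega r s) ->
    `|phi t s x - psi t s x - (phi t s y - psi t s y)| <=
      eps * delta T * (1 + lambda) * varpi (omega r t);
  close_defect : forall r s t x, simplex3 T r s t ->
    `|defect phi t s r x - defect psi t s r x| <= eps * varpi (omega r t)
}.

Lemma flow_closexx phi : flow_close 0 phi phi.
Proof.
split=> // *; rewrite ?subrr ?normr0 ?mul0r //.
Qed.

Lemma defect_diag M phi s x : almost_flow T delta varpi omega M phi ->
  simplex2 T s s -> defect phi s s s x = 0.
Proof.
by move=> phiM ss; rewrite /defect !(almost_flow_diag phiM) // subrr.
Qed.

Lemma d_A_close M eps phi psi :
  almost_flow T delta varpi omega M phi ->
  almost_flow T delta varpi omega M psi ->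
  0 <= eps -> (d_A T delta varpi omega phi psi <= eps%:E)%E ->
  flow_close eps phi psi.
Proof.
move=> phiM psiM eps0; rewrite /d_A !ge_max => /andP[/andP[dsup dO] ddef].
split=> //.
- move=> s t x st; rewrite -[_ - _]/(Defs.diff phi psi t s x); apply: supnorm_bound.
  by apply: le_trans dsup; apply: ereal_sup_ubound; exists (s, t).
- by move=> r s t lambda x y rst l0 xy; exact: normO_bound dO rst l0 xy.
- move=> r s t x rst; have [rt|rt] := eqVneq r t.
    have [? rs st ?] := rst; have sr : s = r by lra.
    rewrite -rt sr !(defect_diag x phiM, defect_diag x psiM) ?subrr ?normr0; last first.
    + by split=> //; lra.
    + by split=> //; lra.
    by rewrite mulr_ge0 //; apply: (varpi_omega_ge0 Hstd); split=> //; lra.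
  apply: (sup_div_varpi_bound ddef rst rt) => //.
  by apply: ereal_sup_ubound; exists x.
Qed.

Section stable_bounds.
Context (M : R) (phi : R -> R -> V -> V).
Hypothesis phi_stable : stable_almost_flow T delta varpi omega M phi.

Lemma stable_flow_lip s t x y : simplex2 T s t ->
  `|phi t s x - phi t s y| <= (1 + delta T) * `|x - y|.
Proof.
move=> st; have := lipnorm_bound x y (stable_lip phi_stable st).
rewrite /hat => hatxy.
have -> : phi t s x - phi t s y = (x - y) + (phi t s x - x - (phi t s y - y)).
  by rewrite opprB addrACA [x + _]addrC subrK addKr.
by apply: le_trans (ler_normD _ _) _; rewrite mulrDl mul1r lerD2l.
Qed.

(** For [r = t], a case that the supremum over [r != t] leaves out, both defects
    vanish. *)
Lemma stable_defect : exists2 C, 0 <= C & forall r s t x y, simplex3 T r s t ->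
  `|defect phi t s r x - defect phi t s r y| <=
    C * varpi (omega r t) * `|x - y|.
Proof.
have phiM := stable_almost phi_stable.
have [C C0 bound] : exists2 C, 0 <= C &
    (sup_div_varpi T varpi omega (fun r s t => lipnorm (defect phi t s r)) <= C%:E)%E.
  move: (stable_defect_lip phi_stable); set S := sup_div_varpi _ _ _ _.
  case: S => [C||] // _; last by exists 0; rewrite // leNye.
  exists (Num.max C 0); first by rewrite le_max lexx orbT.
  by rewrite lee_fin le_max lexx.
exists C => // r s t x y rst; have [rt|rt] := eqVneq r t.
  have [? rs st ?] := rst; have sr : s = r by lra.
  have rr : simplex2 T r r by split=> //; lra.
  rewrite -rt sr !(defect_diag _ phiM) // subrr normr0 !mulr_ge0 //.
  exact: (varpi_omega_ge0 Hstd).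
have [<-|xy] := eqVneq x y; first by rewrite !subrr normr0 mulr0.
have xy0 : 0 < `|x - y| by rewrite normr_gt0 subr_eq0.
rewrite -ler_pdivrMr //.
apply: (sup_div_varpi_bound bound rst rt); first by rewrite divr_ge0.
by apply: ereal_sup_ubound; exists (x, y).
Qed.

End stable_bounds.

End pointwise.

(** * Uniform 4-points control *)

(* Identities between signed sums of vectors: move everything to one side, then
   bring each letter next to its opposite. *)
Ltac zmod_start := apply: subr0_eq; rewrite !(opprD, opprK) -[LHS]addr0 -!addrA.
Ltac zmod_cancel x := rewrite ?(addrCA _ (- x)) ?(addrCA _ x) addNKr.

Section four_points.
Context {R : realType} {V : normedModType R}.
Context (T : R) (delta varpi : R -> R) (omega : R -> R -> R) (kappa : R).
Hypothesis Hstd : standing_assumptions T delta varpi omega kappa.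
Context (phi : R -> R -> V -> V).
Hypothesis phi_cont : forall s t, simplex2 T s t -> continuous (phi t s).

Definition four_points_bound (K r s t : R) (a b c d : V) : Prop :=
  `|phi t s a - phi t s b - phi t s c + phi t s d| <=
    K * varpi (omega r t) * Num.max `|a - c| `|b - d|
    + (1 + delta T) * `|a - b - c + d|.

(** The 4-points bound for all pairs of segments whose longer one has length
    exactly [alpha * varpi (omega r s)]; the factor [alpha] is kept apart from
    the shapes [u] and [v] so that the set of good [alpha] is visibly closed. *)
Definition four_points_at (K alpha : R) : Prop :=
  forall r s t a u c v, simplex3 T r s t ->
    Num.max `|u| `|v| = varpi (omega r s) ->
    four_points_bound K r s t a (a + alpha *: u) c (c + alpha *: v).

Lemma max_norm_ge0 (x y : V) : 0 <= Num.max `|x| `|y|.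
Proof. by rewrite le_max normr_ge0. Qed.

Lemma four_points_boundW K K' r s t a b c d : simplex3 T r s t -> K <= K' ->
  four_points_bound K r s t a b c d -> four_points_bound K' r s t a b c d.
Proof.
move=> rst KK'; rewrite /four_points_bound => /le_trans; apply.
rewrite lerD2r; apply: ler_wpM2r; first exact: max_norm_ge0.
by apply: ler_wpM2r => //; apply: (varpi_omega_ge0 Hstd); apply: simplex3_13 rst.
Qed.

Lemma four_points_control_at : four_points_control T delta varpi omega phi ->
  forall alpha, 0 <= alpha -> exists K, four_points_at K alpha.
Proof.
move=> [check [star [check0 star0 check_star fp]]] alpha alpha0.
exists (star alpha) => r s t a u c v rst uvw.
apply: le_trans (fp _ _ _ _ _ _ (simplex3_23 rst)) _.
rewrite lerD2r; apply: ler_wpM2r; first exact: max_norm_ge0.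
have -> : Num.max `|a - (a + alpha *: u)| `|c - (c + alpha *: v)| =
    alpha * varpi (omega r s).
  rewrite !opprD !addNKr !normrN !normrZ ger0_norm // -uvw.
  by rewrite maxr_pMr.
exact: check_star.
Qed.

Lemma four_points_at_closed K : closed [set alpha | four_points_at K alpha].
Proof.
move=> alpha cl r s t a u c v rst uvw.
pose rhs (x : R) : R := K * varpi (omega r t) *
    Num.max `|a - c| `|a + x *: u - (c + x *: v)|
    + (1 + delta T) * `|a - (a + x *: u) - c + (c + x *: v)|.
pose lhs (x : R) : R := `|phi t s a - phi t s (a + x *: u) - phi t s c
    + phi t s (c + x *: v)|.
have move_cont (y z : V) : continuous (fun x : R => y + x *: z).
  by move=> x; apply: cvgD; [exact: cvg_cst | apply: cvgZr_tmp; exact: cvg_id].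
have phi_move (y z : V) : continuous (fun x : R => phi t s (y + x *: z)).
  move=> x; apply: (continuous_comp (move_cont y z x)).
  exact/phi_cont/(simplex3_23 rst).
have cont : continuous (fun x => rhs x - lhs x).
  move=> x; apply: cvgB.
    apply: cvgD; apply: cvgM; try exact: cvg_cst.
      have mc : {for x, continuous ((fun=> `|a - c|) \max
          (fun x => `|a + x *: u - (c + x *: v)|) : R -> R^o)}.
        apply: continuous_max; first exact: cvg_cst.
        by apply: cvg_norm; apply: cvgB; exact: move_cont.
      exact: mc.
    apply: cvg_norm; apply: cvgD; last exact: move_cont.
    by apply: cvgB; last exact: cvg_cst; apply: cvgB; [exact: cvg_cst|exact: move_cont].
  apply: cvg_norm; apply: cvgD; last exact: phi_move.
  by apply: cvgB; last exact: cvg_cst; apply: cvgB; [exact: cvg_cst|exact: phi_move].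
have closed_nonneg : closed ((fun x => rhs x - lhs x) @^-1` [set y | 0 <= y]).
  by apply: closed_comp => //; exact: closed_ge.
have := closed_nonneg alpha; rewrite /preimage /= subr_ge0; apply.
apply: closureS cl => x /= fpx; rewrite subr_ge0; exact: fpx.
Qed.

(** The closed sets of the [alpha] that are good for the constant [n] cover the
    positive half-line, hence one of them contains an interval by Baire's
    theorem. *)
Lemma four_points_interval : four_points_control T delta varpi omega phi ->
  exists K m eta, [/\ 0 <= K, 0 < eta, 0 < m - eta &
    forall alpha, m - eta <= alpha <= m + eta -> four_points_at K alpha].
Proof.
move=> /four_points_control_at control.
(* The half-line [1, +oo) is parametrized by [1 + `|x|], since Baire's theorem
   is used on the whole line. *)
pose E n : set R := [set x | four_points_at n%:R (1 + `|x|)].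
have E_closed n : closed (E n).
  apply: (@closed_comp _ _ (fun x : R => 1 + `|x|)
    [set alpha | four_points_at n%:R alpha]); last exact: four_points_at_closed.
  move=> x _; apply: cvgD; first exact: cvg_cst.
  by apply: cvg_norm; exact: cvg_id.
have [n [x0 [r r0 ball_E]]] : exists n x0, exists2 r, 0 < r &
    forall x, `|x0 - x| < r -> E n x.
  apply: contrapT => noE.
  have E_dense n : open (~` E n) /\ dense (~` E n).
    split; first exact/closed_openC/E_closed.
    move=> O [x Ox] Oopen; apply: contrapT => OE; apply: noE.
    have /nbhs_ballP[r /= r0 rO] := open_nbhs_nbhs (conj Oopen Ox).
    exists n, x, r => // y yx; apply: contrapT => nEy; apply: OE.
    by exists y; split=> //; apply: rO.
  have [] := @Baire _ (R : completeNormedModType R) (fun n => ~` E n) E_dense setT.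
  - by exists 0.
  - exact: openT.
  move=> x [_ xE].
  have [|K KP] := control (1 + `|x|); first by rewrite addr_ge0.
  apply: (xE (Num.truncn K).+1 I) => r s t a u c v rst uvw.
  by apply: four_points_boundW (KP _ _ _ _ _ _ _ rst uvw); rewrite // ltW // truncnS_gt.
exists n%:R, (1 + `|x0| + r / 4), (r / 4); split=> //; first lra.
  by have := normr_ge0 x0; lra.
move=> alpha /andP[lo hi].
have tau0 : 0 <= alpha - 1 - `|x0| by lra.
pose x := if 0 <= x0 then x0 + (alpha - 1 - `|x0|) else x0 - (alpha - 1 - `|x0|).
have xalpha : 1 + `|x| = alpha.
  rewrite /x; case: (leP 0 x0) => x00.
    by rewrite [in LHS]ger0_norm; rewrite ?(ger0_norm x00) in tau0 *; lra.
  by rewrite [`|x0 - _|]ler0_norm; rewrite ?(ltr0_norm x00) in tau0 *; lra.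
rewrite -xalpha; apply: ball_E.
rewrite /x; case: (leP 0 x0) => x00.
  by rewrite opprD addNKr normrN ger0_norm //; lra.
by rewrite opprB addrC subrK ger0_norm //; lra.
Qed.

Lemma four_points_at_bound K alpha r s t a b c d : 0 < alpha ->
  four_points_at K alpha -> simplex3 T r s t ->
  Num.max `|a - b| `|c - d| = alpha * varpi (omega r s) ->
  four_points_bound K r s t a b c d.
Proof.
move=> alpha0 at_alpha rst scale.
have an0 : alpha != 0 by rewrite gt_eqF.
have move_to (x y : V) : x + alpha *: (alpha^-1 *: (y - x)) = y.
  by rewrite scalerA divff // scale1r addrC subrK.
have := at_alpha r s t a (alpha^-1 *: (b - a)) c (alpha^-1 *: (d - c)) rst.
rewrite !move_to; apply.
have aV0 : 0 <= alpha^-1 by rewrite invr_ge0 ltW.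
rewrite !normrZ ger0_norm // -maxr_pMr // !(distrC b, distrC d) scale.
by rewrite mulKf.
Qed.

(** Reduces short segments to lengths in the good interval: translating [b] and
    [d] by the same long vector [u] leaves [a - b - c + d] unchanged, and the
    error made, the 4-points difference of the parallel segments [b, b + u] and
    [d, d + u], is of the same kind. *)
Lemma four_points_small K m eta r s t a b c d (v : V) : v != 0 -> 0 <= K -> 0 < eta ->
  0 < m - eta ->
  (forall alpha, m - eta <= alpha <= m + eta -> four_points_at K alpha) ->
  simplex3 T r s t ->
  `|a - b| <= eta * varpi (omega r s) -> `|c - d| <= eta * varpi (omega r s) ->
  four_points_bound (2 * K) r s t a b c d.
Proof.
move=> v0 K0 eta0 m0 interval rst ab cd.
have w0 := varpi_omega_ge0 Hstd (simplex3_12 rst).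
have W0 := varpi_omega_ge0 Hstd (simplex3_13 rst).
have dT0 := deltaT_ge0 Hstd.
(* At scale [0] both segments are points. *)
move: w0; rewrite le_eqVlt => /orP[/eqP w0|w0].
  move: ab cd; rewrite -w0 mulr0 !normr_le0 !subr_eq0 => /eqP-> /eqP->.
  rewrite /four_points_bound subrr sub0r addNr normr0.
  by rewrite addr_ge0 ?mulr_ge0 ?max_norm_ge0 //; lra.
set w := varpi (omega r s) in w0 ab cd.
pose u := (m * w / `|v|) *: v.
have nu : `|u| = m * w.
  rewrite normrZ ger0_norm; first by rewrite divfK // normr_eq0.
  by rewrite divr_ge0 // mulr_ge0 // ltW //; lra.
have sub_u (x y : V) : `|x - y| <= eta * w -> m * w - eta * w <= `|x - (y + u)| <= m * w + eta * w.
  move=> xy; rewrite opprD addrA; apply/andP; split.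
    have := lerB_dist u (x - y); rewrite distrC nu; lra.
  by have := ler_normB (x - y) u; rewrite nu; lra.
have /andP[lo1 hi1] := sub_u _ _ ab; have /andP[lo2 hi2] := sub_u _ _ cd.
set X := Num.max `|a - (b + u)| `|c - (d + u)|.
have loX : m * w - eta * w <= X by rewrite le_max lo1.
have hiX : X <= m * w + eta * w by rewrite ge_max hi1.
have far : four_points_bound K r s t a (b + u) c (d + u).
  apply: (@four_points_at_bound K (X / w)) => //.
  - by rewrite divr_gt0 //; apply: lt_le_trans loX; rewrite -mulrBl mulr_gt0.
  - by apply: interval; rewrite ler_pdivlMr // ler_pdivrMr // mulrBl mulrDl loX.
  - by rewrite -/w divfK // gt_eqF.
have trans : four_points_bound K r s t b (b + u) d (d + u).
  apply: (@four_points_at_bound K m) => //; first by lra.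
    by apply: interval; apply/andP; split; lra.
  by rewrite !opprD !addNKr normrN maxxx nu.
move: far trans; rewrite /four_points_bound.
have -> : b + u - (d + u) = b - d by rewrite opprD addrACA subrr addr0.
have -> : b - (b + u) - d + (d + u) = 0.
  by rewrite opprD addNKr addrA addrNK addNr.
have -> : a - (b + u) - c + (d + u) = a - b - c + d.
  by zmod_start; zmod_cancel a; zmod_cancel b; zmod_cancel c; zmod_cancel d; zmod_cancel u.
rewrite normr0 mulr0 addr0 maxxx => far trans.
have bd : `|b - d| <= Num.max `|a - c| `|b - d| by rewrite le_max lexx orbT.
have bdK := ler_wpM2l (mulr_ge0 K0 W0) bd.
set P := phi t s in far trans *.
have -> : P a - P b - P c + P d =
    (P a - P (b + u) - P c + P (d + u)) - (P b - P (b + u) - P d + P (d + u)).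
  zmod_start; zmod_cancel (P a); zmod_cancel (P b); zmod_cancel (P c).
  by zmod_cancel (P d); zmod_cancel (P (b + u)); zmod_cancel (P (d + u)).
apply: le_trans (ler_normB _ _) _; lra.
Qed.

(** Cut both segments at their midpoints: each half carries half of
    [a - b - c + d], so the factor [1 + delta T] does not deteriorate. *)
Lemma four_points_double K h r s t :
  (forall a b c d, `|a - b| <= h -> `|c - d| <= h ->
    four_points_bound K r s t a b c d) ->
  0 <= K * varpi (omega r t) ->
  forall a b c d, `|a - b| <= 2 * h -> `|c - d| <= 2 * h ->
    four_points_bound (2 * K) r s t a b c d.
Proof.
move=> half KW0 a b c d ab cd.
pose mid (x y : V) : V := 2^-1 *: (x + y).
have half_norm (x : V) : `|2^-1 *: x| = `|x| / 2.
  by rewrite normrZ ger0_norm ?invr_ge0 // mulrC.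
have split2 (x : V) : x = 2^-1 *: x + 2^-1 *: x.
  rewrite -scalerDl (_ : 2^-1 + 2^-1 = 1 :> R) ?scale1r //; lra.
have midl x y : x - mid x y = 2^-1 *: (x - y).
  by rewrite {1}[x]split2 /mid scalerDr opprD addrACA subrr add0r scalerBr.
have midr x y : mid x y - y = 2^-1 *: (x - y).
  by rewrite {2}[y]split2 /mid scalerDr opprD addrACA subrr addr0 scalerBr.
have midB x y x' y' : mid x y - mid x' y' = 2^-1 *: (x - x') + 2^-1 *: (y - y').
  by rewrite -scalerDr -scalerBr opprD addrACA.
have quadE (x y z w : V) : x - y - z + w = x - y - (z - w).
  by rewrite opprB [w - z]addrC addrA.
have q1 : a - mid a b - c + mid c d = 2^-1 *: (a - b - c + d).
  by rewrite 2!quadE !midl -scalerBr.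
have q2 : mid a b - b - mid c d + d = 2^-1 *: (a - b - c + d).
  by rewrite 2!quadE !midr -scalerBr.
have first_half : four_points_bound K r s t a (mid a b) c (mid c d).
  by apply: half; rewrite midl half_norm ler_pdivrMr // mulrC.
have second_half : four_points_bound K r s t (mid a b) b (mid c d) d.
  by apply: half; rewrite midr half_norm ler_pdivrMr // mulrC.
move: first_half second_half; rewrite /four_points_bound q1 q2 half_norm.
set Q := `|_ - b - c + d|; set D := Num.max `|a - c| `|b - d|.
have ac : `|a - c| <= D by rewrite le_max lexx.
have bd : `|b - d| <= D by rewrite le_max lexx orbT.
have midD : `|mid a b - mid c d| <= D.
  by rewrite midB; apply: le_trans (ler_normD _ _) _; rewrite !half_norm; lra.
set D1 := Num.max _ _ => first_half; set D2 := Num.max _ _ => second_half.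
have D1D : D1 <= D by rewrite ge_max ac.
have D2D : D2 <= D by rewrite ge_max midD.
have := ler_wpM2l KW0 D1D; have := ler_wpM2l KW0 D2D.
set P := phi t s in first_half second_half *.
have -> : P a - P b - P c + P d = (P a - P (mid a b) - P c + P (mid c d)) +
    (P (mid a b) - P b - P (mid c d) + P d).
  zmod_start; zmod_cancel (P a); zmod_cancel (P b); zmod_cancel (P c).
  by zmod_cancel (P d); zmod_cancel (P (mid a b)); zmod_cancel (P (mid c d)).
move=> ? ?; apply: le_trans (ler_normD _ _) _; lra.
Qed.

(** Small scales come from [four_points_small], larger ones from doubling. *)
Lemma four_points_uniform L : four_points_control T delta varpi omega phi ->
  exists2 C, 0 <= C & forall r s t a b c d, simplex3 T r s t ->
    `|a - b| <= L * varpi (omega r s) -> `|c - d| <= L * varpi (omega r s) ->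
    four_points_bound C r s t a b c d.
Proof.
move=> /four_points_interval[K [m [eta [K0 eta0 m0 interval]]]].
have dT0 := deltaT_ge0 Hstd.
have [V0|] := pselect (forall v : V, v = 0).
  exists 0 => // r s t a b c d rst _ _; rewrite /four_points_bound.
  by rewrite [X in `|X|]V0 normr0 !mul0r add0r mulr_ge0 //; lra.
move=> /existsNP[v /eqP v0].
have scales n r s t a b c d : simplex3 T r s t ->
    `|a - b| <= 2 ^+ n * eta * varpi (omega r s) ->
    `|c - d| <= 2 ^+ n * eta * varpi (omega r s) ->
    four_points_bound (2 ^+ n * (2 * K)) r s t a b c d.
  move=> rst; elim: n a b c d => [|n IHn] a b c d.
    by rewrite expr0 !mul1r; exact: (four_points_small v0 K0 eta0 m0 interval rst).
  rewrite exprS -!mulrA ![2 ^+ n * (eta * _)]mulrA => ab cd.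
  apply: four_points_double ab cd; first exact: IHn.
  rewrite !mulr_ge0 ?exprn_ge0 //.
  exact: (varpi_omega_ge0 Hstd (simplex3_13 rst)).
have [n nL] := geometric_small (L / eta) (ltac:(lra) : 0 <= (2^-1 : R)) ltac:(lra) ltr01.
have p0 : 0 < (2 : R) ^+ n by rewrite exprn_gt0.
have Ln : L <= 2 ^+ n * eta.
  move: nL; rewrite exprVn mulrC -mulrA -invfM ler_pdivrMr ?mul1r 1?mulrC //.
  by rewrite mulr_gt0.
exists (2 ^+ n * (2 * K)); first by rewrite !mulr_ge0 // ltW.
move=> r s t a b c d rst ab cd.
have w0 := varpi_omega_ge0 Hstd (simplex3_12 rst).
by apply: scales => //; [apply: le_trans ab _ | apply: le_trans cd _]; apply: ler_wpM2r.
Qed.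

End four_points.

(** * Davie's estimate *)

Section sewing.
Context {R : realType} {V : normedModType R}.
Context (T : R) (delta varpi : R -> R) (omega : R -> R -> R) (kappa M : R).
Hypothesis Hstd : standing_assumptions T delta varpi omega kappa.
Hypothesis M_ge0 : 0 <= M.
Implicit Types (phi psi : R -> R -> V -> V) (S : set R) (y z : R -> V).

(** Common form of schemes, on the points of their partition, and of D-solutions,
    on [0, T]. *)
Definition approx_solution phi (L : R) S y : Prop :=
  forall s t, S s -> S t -> s <= t ->
    `|y t - phi t s (y s)| <= L * varpi (omega s t).

(** Davie's splitting within the time set [S]: the two main pieces carry at most
    half of the control, and the piece [s, s'] between them contributes an
    arbitrarily small error. *)
Definition splits S (err : R -> R -> R) : Prop :=
  forall r t eta, S r -> S t -> r < t -> 0 < eta ->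
    exists s s', [/\ S s /\ S s', [/\ r <= s, s <= s' & s' <= t],
      omega r s <= omega r t / 2, omega s' t <= omega r t / 2 & err s s' <= eta].

(** The fixed point of the recursion in [sewing_split]. *)
Definition sewing_const : R :=
  (2 * delta T + 2 * M) / (1 - (kappa + 2 * delta T)).

Lemma sewing_const_ge0 : 0 <= sewing_const.
Proof.
have dT0 := deltaT_ge0 Hstd; have kd := kappa_delta_lt1 Hstd; have M0 := M_ge0.
by rewrite /sewing_const; apply: divr_ge0; lra.
Qed.

Section one_flow.
Context (phi : R -> R -> V -> V).
Hypothesis phiM : almost_flow T delta varpi omega M phi.

Lemma sewing_step y r s t K : simplex3 T r s t -> 0 <= K ->
  `|y s - phi s r (y r)| <= K * varpi (omega r s) ->
  `|y t - phi t r (y r)| <= `|y t - phi t s (y s)| + `|y s - phi s r (y r)|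
    + (delta T * (1 + K) + M) * varpi (omega r t).
Proof.
move=> rst K0 ys.
have osc_le := almost_flow_osc Hstd phiM rst K0 ys.
have defect_le := almost_flow_defect phiM (y r) rst.
apply: le_trans (ler_distD (phi t s (y s)) _ _) _.
have := ler_distD (phi t s (phi s r (y r))) (phi t s (y s)) (phi t r (y r)).
lra.
Qed.

(** Passing from [r] to [t] through [s] and [s'] costs two oscillation terms and
    two defects, whence the coefficient [kappa + 2 * delta T] in front of [K]. *)
Lemma sewing_split y r s s' t K eta : simplex3 T r s t -> simplex3 T s s' t ->
  0 <= K ->
  omega r s <= omega r t / 2 -> omega s' t <= omega r t / 2 ->
  `|y s - phi s r (y r)| <= K * varpi (omega r s) ->
  `|y s' - phi s' s (y s)| <= K * varpi (omega s s') ->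
  `|y s' - phi s' s (y s)| <= eta ->
  `|y t - phi t s' (y s')| <= K * varpi (omega s' t) ->
  `|y t - phi t r (y r)| <=
    ((kappa + 2 * delta T) * K + (2 * delta T + 2 * M)) * varpi (omega r t) + eta.
Proof.
move=> rst ss't K0 half1 half2 ys ys' ys'eta yt.
have step1 := sewing_step rst K0 ys.
have step2 := sewing_step ss't K0 ys'.
have rt := simplex3_13 rst.
have v1 := ler_wpM2l K0 (varpi_omega_half Hstd (simplex3_12 rst) rt half1).
have v2 := ler_wpM2l K0 (varpi_omega_half Hstd (simplex3_23 ss't) rt half2).
have c0 : 0 <= delta T * (1 + K) + M.
  by rewrite addr_ge0 // mulr_ge0 ?(deltaT_ge0 Hstd) //; lra.
have := ler_wpM2l c0 (varpi_omega_right Hstd rst).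
nra.
Qed.

Lemma splits_partition s0 p (err : R -> R -> R) : 0 <= s0 ->
  itv_partition s0 T p ->
  (forall k, (k < size p)%N ->
    err (nth T (s0 :: p) k) (nth T (s0 :: p) k.+1) = 0) ->
  splits [set` s0 :: p] err.
Proof.
move=> s00 s0p err0 r t eta /(grid_index T)[i ip <-] /(grid_index T)[j jp <-].
set tt := nth T (s0 :: p) => ij eta0.
have mem k : (k <= size p)%N -> [set` s0 :: p] (tt k) by move=> kp; apply: mem_nth.
have ttS k : tt k <= tt k.+1 := grid_nondecreasing s0p k.
have mono : {homo tt : a b / (a <= b)%N >-> a <= b}.
  exact: homo_leq le_refl le_trans ttS.
have ltij : (i < j)%N by rewrite ltnNge; apply/negP => /mono; lra.
have bounds k : 0 <= tt k <= T.
  by case/andP: (grid_bounds s0p k) => lo ->; rewrite (le_trans s00 lo).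
have [k [ik kj half1 half2]] := control_split Hstd bounds ttS ltij.
exists (tt k), (tt k.+1); split=> //; first by split; apply: mem; [exact: leq_trans (ltnW kj) jp | exact: leq_trans kj jp].
- by split; [exact: mono|exact: ttS|exact: mono].
- by rewrite err0 ?ltW // (leq_trans kj jp).
Qed.

(** By induction on the number of steps, the error over a single step being
    zero. *)
Lemma scheme_approx_solution s0 x p : 0 <= s0 -> itv_partition s0 T p ->
  approx_solution phi sewing_const [set` s0 :: p] (scheme phi s0 x p).
Proof.
move=> s00 s0p s t /(grid_index T)[i ip <-] /(grid_index T)[j jp <-].
set tt := nth T (s0 :: p); set y := scheme phi s0 x p.
have ttS k : tt k <= tt k.+1 := grid_nondecreasing s0p k.
have mono : {homo tt : a b / (a <= b)%N >-> a <= b}.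
  exact: homo_leq le_refl le_trans ttS.
have bounds k : 0 <= tt k <= T.
  by case/andP: (grid_bounds s0p k) => lo ->; rewrite (le_trans s00 lo).
have simp3 a b c : (a <= b)%N -> (b <= c)%N -> simplex3 T (tt a) (tt b) (tt c).
  by move=> ab bc; split; rewrite ?mono //; case/andP: (bounds a); case/andP: (bounds c).
have simp2 a b : (a <= b)%N -> simplex2 T (tt a) (tt b).
  by move=> ab; apply: simplex3_13 (simp3 a b b ab _).
have L0 := sewing_const_ge0.
have L_fix : (kappa + 2 * delta T) * sewing_const + (2 * delta T + 2 * M) =
    sewing_const.
  by rewrite /sewing_const; field; have := kappa_delta_lt1 Hstd; lra.
have diag k : `|y (tt k) - phi (tt k) (tt k) (y (tt k))| <= 0.
  by rewrite (almost_flow_diag Hstd phiM) ?subrr ?normr0 //; apply: simp2.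
suff main n : forall a b, (a <= b <= size p)%N -> (b - a <= n)%N ->
    `|y (tt b) - phi (tt b) (tt a) (y (tt a))| <=
      sewing_const * varpi (omega (tt a) (tt b)).
  case: (leqP i j) => ij tij; first by apply: (main j) => //; rewrite ?ij // leq_subr.
  have -> : tt i = tt j by apply: le_anti; rewrite tij mono // ltnW.
  apply: le_trans (diag j) _; apply: mulr_ge0 => //.
  exact: (varpi_omega_ge0 Hstd (simp2 _ _ (leqnn j))).
elim: n => [|n IHn] a b /andP[ab bp] ban.
  have -> : a = b by lia.
  apply: le_trans (diag b) _; apply: mulr_ge0 => //.
  exact: (varpi_omega_ge0 Hstd (simp2 _ _ (leqnn b))).
move: ab; rewrite leq_eqVlt => /orP[/eqP <-|ab].
  apply: le_trans (diag a) _; apply: mulr_ge0 => //.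
  exact: (varpi_omega_ge0 Hstd (simp2 _ _ (leqnn a))).
have [k [ak kb half1 half2]] := control_split Hstd bounds ttS ab.
have one_step : `|y (tt k.+1) - phi (tt k.+1) (tt k) (y (tt k))| <= 0.
  by rewrite /y /tt (scheme_step _ _ s0p (leq_trans kb bp)) subrr normr0.
rewrite -L_fix -[leRHS]addr0.
apply: (sewing_split (s := tt k) (s' := tt k.+1)) => //.
- by apply: simp3 => //; apply: ltnW.
- by apply: simp3.
- by apply: IHn; lia.
- apply: le_trans one_step _; apply: mulr_ge0 => //.
  exact: (varpi_omega_ge0 Hstd (simp2 _ _ (leqnSn k))).
- by apply: IHn; lia.
Qed.

End one_flow.

(** Split a fine uniform subdivision of [r, t]; the error over one step is small
    since the control is uniformly small near the diagonal. *)
Lemma splits_interval K (err : R -> R -> R) : 0 <= K ->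
  (forall s t, simplex2 T s t -> err s t <= K * varpi (omega s t)) ->
  splits `[0, T] err.
Proof.
move=> K0 errK r t eta; rewrite /= !in_itv /= => /andP[r0 rT] /andP[t0 tT] rt eta0.
have e0 : 0 < eta / (K + 1) by rewrite divr_gt0 //; lra.
have [h h0 small] := varpi_omega_small Hstd e0.
pose tt k : R := Num.min t (r + k%:R * h).
have hk k : 0 <= k%:R * h by rewrite mulr_ge0 // ltW.
have tt_r k : r <= tt k by rewrite le_min ltW //= lerDl.
have tt_t k : tt k <= t by rewrite ge_min lexx.
have bounds k : 0 <= tt k <= T.
  by rewrite (le_trans r0 (tt_r k)) (le_trans (tt_t k) tT).
have ttS k : tt k <= tt k.+1.
  by rewrite /tt le_min ge_min lexx /= ge_min -natr1 mulrDl mul1r; apply/orP; right; lra.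
have tt_gap k : tt k.+1 <= tt k + h.
  rewrite /tt -natr1 mulrDl mul1r; case: (leP t (r + k%:R * h)) => _.
    by rewrite ge_min; apply/orP; left; lra.
  by rewrite ge_min; apply/orP; right; lra.
have tt0 : tt 0%N = r by rewrite /tt mul0r addr0 min_r // ltW.
pose n := (Num.truncn ((t - r) / h)).+1.
have ttn : tt n = t.
  rewrite /tt min_l //; have : t - r <= n%:R * h by rewrite -ler_pdivrMr // ltW // truncnS_gt.
  lra.
have [k [_ kn]] := control_split Hstd bounds ttS (ltn0Sn (Num.truncn ((t - r) / h))).
rewrite -/n ttn tt0 => half1 half2.
have kk : simplex2 T (tt k) (tt k.+1).
  by split; [case/andP: (bounds k)|exact: ttS|case/andP: (bounds k.+1)].
exists (tt k), (tt k.+1); split=> //=; first by rewrite !in_itv /= !bounds.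
apply: le_trans (errK _ _ kk) _.
have [_ le_e] := small _ _ kk (tt_gap k).
apply: le_trans (ler_wpM2l K0 le_e) _.
rewrite mulrCA; apply: ler_piMr; first exact: ltW.
by rewrite ler_pdivrMr; lra.
Qed.

(** The constant of a D-solution is improved by splitting until it reaches
    [sewing_const], which is the same for all D-solutions of all almost flows of
    the class. *)
Lemma D_solution_approx phi x z : almost_flow T delta varpi omega M phi ->
  D_solution T varpi omega phi x z -> approx_solution phi sewing_const `[0, T] z.
Proof.
move=> phiM [_ _ [K K0 zK]] s t; rewrite /= !in_itv /= => /andP[s0 sT] /andP[t0 tT] st.
have := kappa_delta_lt1 Hstd; have := kappa_gt0 Hstd; have := deltaT_ge0 Hstd.
move=> dT0 k0 kd; have M0 := M_ge0.
have bound := @self_improving_bound R (R * R)%type (fun st => simplex2 T st.1 st.2)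
  (fun st => `|z st.2 - phi st.2 st.1 (z st.1)|) (fun st => varpi (omega st.1 st.2))
  (kappa + 2 * delta T) (2 * delta T + 2 * M) K.
apply: (bound _ _ _ K0 _ _ _ (s, t)); [lra|lra|lra| | | |].
- by move=> [? ?] /= /(varpi_omega_ge0 Hstd).
- by move=> [? ?] /= /zK.
- move=> K' K'0 zK' [r u] /= ru; have [r0 + uT] := ru.
  rewrite le_eqVlt => /orP[/eqP ur|ru'].
    rewrite -ur in ru *; rewrite (almost_flow_diag Hstd phiM) // subrr normr0.
    by rewrite mulr_ge0 ?(varpi_omega_ge0 Hstd) // addr_ge0 ?mulr_ge0 //; lra.
  apply/ler_addgt0Pr => eta eta0.
  have ri : `[0, T]%classic r by rewrite /= in_itv /= r0; lra.
  have ui : `[0, T]%classic u by rewrite /= in_itv /= uT andbT; lra.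
  have [v [v' [[vi v'i] [rv vv' v'u] half1 half2 small]]] :=
    @splits_interval K (fun s t => `|z t - phi t s (z s)|) K0 zK r u eta ri ui ru' eta0.
  apply: (sewing_split phiM (s := v) (s' := v')) => //; try by split=> //; lra.
  + by apply: (zK' (r, v)); split=> //=; lra.
  + by apply: (zK' (v, v')); split=> //=; lra.
  + by apply: (zK' (v', u)); split=> //=; lra.
- by [].
Qed.

End sewing.

(** * Stability *)

Section stability.
Context {R : realType} {V : normedModType R}.
Context (T : R) (delta varpi : R -> R) (omega : R -> R -> R) (kappa M : R).
Hypothesis Hstd : standing_assumptions T delta varpi omega kappa.
Hypothesis M_ge0 : 0 <= M.
Implicit Types (S : set R) (y z : R -> V).

Notation L := (sewing_const T delta kappa M).

(** The signs are those of a 4-points difference: the gap over [r, s] is the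
    second-order term of the 4-points control applied in [gap_step]. *)
Definition increment_gap (phi psi : R -> R -> V -> V) y z (r t : R) : V :=
  y t - phi t r (y r) - z t + psi t r (z r).

Section fixed_flows.
Context (phi psi : R -> R -> V -> V) (C4 Cd eps : R).
Hypothesis phi_lip : forall s t x x', simplex2 T s t ->
  `|phi t s x - phi t s x'| <= (1 + delta T) * `|x - x'|.
Hypothesis C4_ge0 : 0 <= C4.
Hypothesis phi_four_points : forall r s t a b c d, simplex3 T r s t ->
  `|a - b| <= L * varpi (omega r s) -> `|c - d| <= L * varpi (omega r s) ->
  four_points_bound T delta varpi omega phi C4 r s t a b c d.
Hypothesis Cd_ge0 : 0 <= Cd.
Hypothesis phi_defect : forall r s t x x', simplex3 T r s t ->
  `|defect phi t s r x - defect phi t s r x'| <=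
    Cd * varpi (omega r t) * `|x - x'|.
Hypothesis psi_close : flow_close T delta varpi omega eps phi psi.

Definition gap_rate : R := 2 * C4 + Cd + delta T * (1 + L) + 1.

Lemma gap_rate_ge0 : 0 <= gap_rate.
Proof.
have C40 := C4_ge0; have Cd0 := Cd_ge0; have L0 := sewing_const_ge0 Hstd M_ge0.
have : 0 <= delta T * (1 + L) by rewrite mulr_ge0 ?(deltaT_ge0 Hstd) //; lra.
rewrite /gap_rate; lra.
Qed.

(** The first three terms of the decomposition are the gap over [s, t], a
    4-points difference of [phi], and an oscillation of [phi - psi] between the
    points [z s] and [psi s r (z r)]; the last one compares defects. *)
Lemma gap_step y z r s t D : simplex3 T r s t ->
  `|y s - phi s r (y r)| <= L * varpi (omega r s) ->
  `|z s - psi s r (z r)| <= L * varpi (omega r s) ->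
  `|y r - z r| <= D -> `|y s - z s| <= D ->
  `|increment_gap phi psi y z r t| <= `|increment_gap phi psi y z s t|
    + (1 + delta T) * `|increment_gap phi psi y z r s|
    + gap_rate * (D + eps) * varpi (omega r t).
Proof.
move=> rst ys zs Dr Ds.
have dT0 := deltaT_ge0 Hstd.
have dT1 : delta T <= 1.
  by have := kappa_delta_lt1 Hstd; have := kappa_gt0 Hstd; lra.
have e0 := close_ge0 psi_close.
have L0 := sewing_const_ge0 Hstd M_ge0.
have w0 := varpi_omega_ge0 Hstd (simplex3_13 rst).
have D0 : 0 <= D := le_trans (normr_ge0 _) Dr.
have C40 := C4_ge0; have Cd0 := Cd_ge0.
set W := varpi (omega r t) in w0 *.
have -> : increment_gap phi psi y z r t = increment_gap phi psi y z s t
    + (phi t s (y s) - phi t s (phi s r (y r)) - phi t s (z s) + phi t s (psi s r (z r)))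
    + (phi t s (z s) - psi t s (z s)
       - (phi t s (psi s r (z r)) - psi t s (psi s r (z r))))
    + (defect phi t s r (y r) - defect psi t s r (z r)).
  rewrite /increment_gap /defect; zmod_start.
  zmod_cancel (y t); zmod_cancel (z t); zmod_cancel (phi t r (y r)).
  zmod_cancel (psi t r (z r)); zmod_cancel (phi t s (y s)).
  zmod_cancel (psi t s (z s)); zmod_cancel (phi t s (phi s r (y r))).
  zmod_cancel (phi t s (z s)); zmod_cancel (phi t s (psi s r (z r))).
  by zmod_cancel (psi t s (psi s r (z r))).
have four := phi_four_points rst ys zs; rewrite /four_points_bound -/W in four.
have gap_rs : y s - phi s r (y r) - z s + psi s r (z r) =
  increment_gap phi psi y z r s by [].
rewrite gap_rs in four.
have maxD : Num.max `|y s - z s| `|phi s r (y r) - psi s r (z r)| <= 2 * (D + eps).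
  rewrite ge_max; apply/andP; split; first lra.
  apply: le_trans (ler_distD (phi s r (z r)) _ _) _.
  have := phi_lip (y r) (z r) (simplex3_12 rst).
  have := close_sup psi_close (z r) (simplex3_12 rst).
  have : (1 + delta T) * `|y r - z r| <= 2 * D.
    by apply: ler_pM => //; lra.
  lra.
have fourD := ler_wpM2l (mulr_ge0 C40 w0) maxD.
have oscD := close_osc psi_close rst L0 zs; rewrite -/W in oscD.
have defD : `|defect phi t s r (y r) - defect psi t s r (z r)| <=
    (Cd * D + eps) * W.
  apply: le_trans (ler_distD (defect phi t s r (z r)) _ _) _.
  have := phi_defect (y r) (z r) rst; have := close_defect psi_close (z r) rst.
  have := ler_wpM2l (mulr_ge0 Cd0 w0) Dr; rewrite -/W; lra.
have rest : C4 * W * (2 * (D + eps)) + eps * delta T * (1 + L) * W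
    + (Cd * D + eps) * W <= gap_rate * (D + eps) * W.
  have t1 : 0 <= delta T * (1 + L) * D * W by rewrite !mulr_ge0 //; lra.
  have t2 : 0 <= Cd * eps * W by rewrite !mulr_ge0.
  have t3 : 0 <= D * W by rewrite mulr_ge0.
  rewrite /gap_rate; lra.
apply: le_trans (ler_normD _ _) _.
have := ler_normD (increment_gap phi psi y z s t
    + (phi t s (y s) - phi t s (phi s r (y r)) - phi t s (z s) + phi t s (psi s r (z r))))
    (phi t s (z s) - psi t s (z s)
       - (phi t s (psi s r (z r)) - psi t s (psi s r (z r)))).
have := ler_normD (increment_gap phi psi y z s t)
    (phi t s (y s) - phi t s (phi s r (y r)) - phi t s (z s) + phi t s (psi s r (z r))).
lra.
Qed.

Definition gap_const : R := 2 * gap_rate / (1 - (kappa + delta T)).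

Lemma gap_const_ge0 : 0 <= gap_const.
Proof.
have A0 := gap_rate_ge0; have dT0 := deltaT_ge0 Hstd.
have kd := kappa_delta_lt1 Hstd.
by rewrite /gap_const; apply: divr_ge0; lra.
Qed.

Section window.
Context (S : set R) (y z : R -> V).
Hypothesis S_sub : forall t, S t -> 0 <= t <= T.
Hypothesis y_approx : approx_solution varpi omega phi L S y.
Hypothesis z_approx : approx_solution varpi omega psi L S z.
Hypothesis S_splits : splits omega S (fun r t => `|increment_gap phi psi y z r t|).

Let simp2 s t : S s -> S t -> s <= t -> simplex2 T s t.
Proof. by move=> /S_sub/andP[s0 sT] /S_sub/andP[t0 tT] st; split. Qed.

Let simp3 r s t : S r -> S t -> r <= s -> s <= t -> simplex3 T r s t.
Proof. by move=> /S_sub/andP[s0 sT] /S_sub/andP[t0 tT] st; split. Qed.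

(** Only an a priori bound: it does not vanish with [y - z]. *)
Lemma gap_rough r t : S r -> S t -> r <= t ->
  `|increment_gap phi psi y z r t| <= 2 * L * varpi (omega r t).
Proof.
move=> Sr St rt; have := y_approx Sr St rt; have := z_approx Sr St rt.
have -> : increment_gap phi psi y z r t =
    (y t - phi t r (y r)) - (z t - psi t r (z r)).
  by rewrite /increment_gap opprB addrA addrAC.
have := ler_normB (y t - phi t r (y r)) (z t - psi t r (z r)); lra.
Qed.

(** The two halves contribute
    [(1 + (1 + delta T)) * (kappa / 2) <= kappa + delta T < 1] times the current
    constant. *)
Lemma gap_window D : 0 <= D -> (forall t, S t -> `|y t - z t| <= D) ->
  forall r t, S r -> S t -> r <= t ->
  `|increment_gap phi psi y z r t| <= gap_const * (D + eps) * varpi (omega r t).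
Proof.
move=> D0 yzD r t Sr St rt.
have dT0 := deltaT_ge0 Hstd; have kd := kappa_delta_lt1 Hstd.
have k0 := kappa_gt0 Hstd; have k1 := kappa_lt1 Hstd.
have e0 := close_ge0 psi_close; have A0 := gap_rate_ge0.
have L0 := sewing_const_ge0 Hstd M_ge0.
have AD0 : 0 <= gap_rate * (D + eps) by rewrite mulr_ge0 //; lra.
have -> : gap_const * (D + eps) =
    2 * (gap_rate * (D + eps)) / (1 - (kappa + delta T)).
  by rewrite /gap_const; field; lra.
have bound := @self_improving_bound R (R * R)%type
  (fun st => [/\ S st.1, S st.2 & st.1 <= st.2])
  (fun st => `|increment_gap phi psi y z st.1 st.2|)
  (fun st => varpi (omega st.1 st.2))
  (kappa + delta T) (2 * (gap_rate * (D + eps))) (2 * L).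
apply: (bound _ _ _ _ _ _ _ (r, t)); [lra|lra|lra|lra| | | |by []].
- by move=> [u v] /= [Su Sv uv]; apply: (varpi_omega_ge0 Hstd); apply: simp2.
- by move=> [u v] /= [Su Sv uv]; apply: gap_rough.
move=> {r t Sr St rt} K K0 gapK [r t] /= [Sr St]; rewrite le_eqVlt => /orP[/eqP rt|rt].
  subst t.
  have rr : simplex2 T r r by apply: simp2.
  have := gap_rough Sr Sr (lexx r).
  by rewrite (control_diag (omega_control Hstd) rr) (varpi0 Hstd) !mulr0.
apply/ler_addgt0Pr => eta eta0.
have eta20 : 0 < eta / 2 by rewrite divr_gt0.
have [s [s' [[Ss Ss'] [rs ss' s't] half1 half2 small]]] := S_splits Sr St rt eta20.
have st : s <= t by lra.
have rst := simp3 Sr St rs st; have ss't := simp3 Ss St ss' s't.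
have step1 := gap_step rst (y_approx Sr Ss rs) (z_approx Sr Ss rs) (yzD _ Sr) (yzD _ Ss).
have step2 := gap_step ss't (y_approx Ss Ss' ss') (z_approx Ss Ss' ss')
  (yzD _ Ss) (yzD _ Ss').
have b1 : `|increment_gap phi psi y z r s| <= K * varpi (omega r s) by apply: (gapK (r, s)).
have b2 : `|increment_gap phi psi y z s' t| <= K * varpi (omega s' t) by apply: (gapK (s', t)).
have rt2 := simplex3_13 rst.
have v1 := ler_wpM2l K0 (varpi_omega_half Hstd (simplex3_12 rst) rt2 half1).
have v2 := ler_wpM2l K0 (varpi_omega_half Hstd (simplex3_23 ss't) rt2 half2).
have v3 := ler_wpM2l AD0 (varpi_omega_right Hstd rst).
have w0 := varpi_omega_ge0 Hstd rt2.
set W := varpi (omega r t) in step1 v1 v2 v3 w0 *.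
have d1 : 0 <= 1 + delta T by lra.
have m1 := ler_wpM2l d1 (le_trans b1 v1).
have m2 := ler_wpM2l d1 small.
have m3 : (1 + delta T) * (eta / 2) <= eta.
  by rewrite mulrCA ler_piMr ?ltW //; lra.
have m4 : kappa * (delta T * K * W) <= 1 * (delta T * K * W).
  by apply: ler_wpM2r; rewrite ?mulr_ge0 // ltW.
have m5 : 0 <= delta T * K * W by rewrite !mulr_ge0.
lra.
Qed.

(** [y u - z u] is the gap over [s, u] plus [phi u s (y s) - psi u s (z s)]; on
    a short window the former is at most half of [D + eps], and [D] improves to
    the fixed point of [D |-> D / 2 + 2 `|y s - z s| + 3 / 2 eps]. *)
Lemma window_bound s : S s -> (forall t, S t -> s <= t) ->
  (forall t, S t -> gap_const * varpi (omega s t) <= 2^-1) ->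
  forall t, S t -> `|y t - z t| <= 4 * `|y s - z s| + 3 * eps.
Proof.
move=> Ss s_min s_short t St.
have dT0 := deltaT_ge0 Hstd; have kd := kappa_delta_lt1 Hstd.
have k0 := kappa_gt0 Hstd; have e0 := close_ge0 psi_close.
have L0 := sewing_const_ge0 Hstd M_ge0; have B0 := gap_const_ge0.
set X := `|y s - z s|; have X0 : 0 <= X by exact: normr_ge0.
have flow_dist u : S u -> `|phi u s (y s) - psi u s (z s)| <= 2 * X + eps.
  move=> Su; have su := simp2 Ss Su (s_min _ Su).
  apply: le_trans (ler_distD (phi u s (z s)) _ _) _.
  have := phi_lip (y s) (z s) su; have := close_sup psi_close (z s) su.
  have : (1 + delta T) * `|y s - z s| <= 2 * X by rewrite -/X; apply: ler_wpM2r; lra.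
  lra.
have decomp u : `|y u - z u| <=
    `|increment_gap phi psi y z s u| + `|phi u s (y s) - psi u s (z s)|.
  have -> : y u - z u = increment_gap phi psi y z s u + (phi u s (y s) - psi u s (z s)).
    rewrite /increment_gap; zmod_start; zmod_cancel (y u); zmod_cancel (z u).
    by zmod_cancel (phi u s (y s)); zmod_cancel (psi u s (z s)).
  exact: ler_normD.
have T0 := T_gt0 Hstd.
have wT u : S u -> varpi (omega s u) <= varpi (omega 0 T).
  move=> Su; have [s0 su uT] := simp2 Ss Su (s_min _ Su).
  apply: (@le_trans _ _ (varpi (omega s T))).
    by apply: (varpi_omega_left Hstd); split.
  by apply: (varpi_omega_right Hstd); split=> //; lra.
have wT0 : 0 <= varpi (omega 0 T) by apply: (varpi_omega_ge0 Hstd); split; lra.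
pose K0 := 2 * L * varpi (omega 0 T) + (2 * X + eps).
have LwT0 := mulr_ge0 L0 wT0.
have K00 : 0 <= K0 by rewrite /K0; lra.
have bound := @self_improving_bound R R S (fun u => `|y u - z u|) (fun=> 1)
  2^-1 (2 * X + 3 / 2 * eps) K0.
have -> : 4 * X + 3 * eps = (2 * X + 3 / 2 * eps) / (1 - 2^-1) * 1 by field.
apply: (bound _ _ _ K00 _ _ _ t) => //; try lra.
- move=> u Su; rewrite mulr1; apply: le_trans (decomp u) _; apply: lerD; last exact: flow_dist.
  apply: le_trans (gap_rough Ss Su (s_min _ Su)) _.
  by apply: ler_wpM2l; [lra | exact: wT].
- move=> D D0 yzD u Su; rewrite mulr1; apply: le_trans (decomp u) _.
  have yzD1 v : S v -> `|y v - z v| <= D by move=> /yzD; rewrite mulr1.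
  have gap := gap_window D0 yzD1 Ss Su (s_min _ Su).
  have De0 : 0 <= D + eps by lra.
  have := ler_wpM2l De0 (s_short _ Su); have := flow_dist _ Su.
  lra.
Qed.

End window.

(** Windows start at points of [S], hence their length may reach [2 * h]: a point
    of [S] lies within [h] before the end of the previous window.  One window
    turns [X] into [4 * X + 3 * eps], whence the ratio [7]. *)
Lemma stability_windows S sigma y z h : 0 < h ->
  (forall s t, simplex2 T s t -> t <= s + 2 * h -> gap_const * varpi (omega s t) <= 2^-1) ->
  (forall t, S t -> 0 <= t /\ sigma <= t <= T) -> S sigma ->
  (forall t, sigma <= t <= T -> exists2 s, S s & s <= t <= s + h) ->
  approx_solution varpi omega phi L S y -> approx_solution varpi omega psi L S z ->
  splits omega S (fun r t => `|increment_gap phi psi y z r t|) ->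
  forall n t, S t -> t <= sigma + n%:R * h ->
    `|y t - z t| <= 7 ^+ n * (`|y sigma - z sigma| + eps).
Proof.
move=> h0 short S_sub Ssigma S_gap y_ap z_ap S_sp.
have e0 := close_ge0 psi_close.
set X := `|y sigma - z sigma|; have X0 : 0 <= X by exact: normr_ge0.
elim=> [|n IHn] t St.
  rewrite mul0r addr0 expr0 mul1r => t_le; have [_ /andP[le_t _]] := S_sub _ St.
  have -> : t = sigma by lra.
  by rewrite -/X; lra.
move=> t_le; have [t0 /andP[sigma_t tT]] := S_sub _ St.
have nh : 0 <= n%:R * h by rewrite mulr_ge0 // ltW.
pose u := Num.min t (sigma + n%:R * h).
have [s Ss /andP[su us]] : exists2 s, S s & s <= u <= s + h.
  by apply: S_gap; rewrite le_min sigma_t lerDl nh ge_min tT.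
have [s_t s_n] : s <= t /\ s <= sigma + n%:R * h.
  by move: su; rewrite le_min => /andP[].
have t_s : t <= s + 2 * h.
  move: t_le us; rewrite /u -natr1 mulrDl mul1r; case: (leP t (sigma + n%:R * h)) => _; lra.
have IH := IHn s Ss s_n.
pose S' := [set v | S v /\ s <= v <= t].
have S'S v : S' v -> S v by case.
have : `|y t - z t| <= 4 * `|y s - z s| + 3 * eps.
  apply: (@window_bound S' y z) => //.
  - by move=> v [/S_sub[v0 /andP[_ ->]] _]; rewrite v0.
  - by move=> v w [Sv _] [Sw _]; exact: y_ap.
  - by move=> v w [Sv _] [Sw _]; exact: z_ap.
  - move=> v w eta [Sv /andP[sv vt]] [Sw /andP[sw wt]] vw eta0.
    have [p [q [[Sp Sq] [vp pq qw] h1 h2 small]]] := S_sp _ _ _ Sv Sw vw eta0.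
    by exists p, q; split=> //; split; split=> //; apply/andP; split; lra.
  - by split=> //; rewrite lexx.
  - by move=> v [_ /andP[]].
  - move=> v [Sv /andP[sv vt]]; apply: short; last lra.
    by have [s0 _] := S_sub _ Ss; have [_ /andP[_ vT]] := S_sub _ Sv; split.
  - by split=> //; rewrite s_t lexx.
have p1 : 1 <= 7 ^+ n :> R by rewrite exprn_ege1 //; lra.
have : eps <= 7 ^+ n * (X + eps).
  by apply: (@le_trans _ _ (1 * (X + eps))); [lra | apply: ler_wpM2r => //; lra].
rewrite exprS; lra.
Qed.

End fixed_flows.

(** The constants depend on [phi] only, hence hold on a neighbourhood of [phi]. *)
Lemma stability phi : stable_almost_flow T delta varpi omega M phi ->
  exists h C, [/\ 0 < h, 0 <= C &
    forall psi eps S sigma y z, flow_close T delta varpi omega eps phi psi ->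
    (forall t, S t -> 0 <= t /\ sigma <= t <= T) -> S sigma ->
    (forall t, sigma <= t <= T -> exists2 s, S s & s <= t <= s + h) ->
    approx_solution varpi omega phi L S y -> approx_solution varpi omega psi L S z ->
    splits omega S (fun r t => `|increment_gap phi psi y z r t|) ->
    forall t, S t -> `|y t - z t| <= C * (`|y sigma - z sigma| + eps)].
Proof.
move=> phi_stable.
have phiM := stable_almost phi_stable.
have phi_cont s t (st : simplex2 T s t) := almost_flow_continuous phiM st.
have [C4 C40 four] := four_points_uniform Hstd phi_cont L (stable_four_points phi_stable).
have [Cd Cd0 def] := stable_defect Hstd phi_stable.
have lip s t x x' (st : simplex2 T s t) := stable_flow_lip phi_stable x x' st.
have B0 := gap_const_ge0 C40 Cd0.
set B := gap_const C4 Cd in B0.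
have e0 : 0 < (2 * (B + 1))^-1 by rewrite invr_gt0; lra.
have [h h0 small] := varpi_omega_small Hstd e0.
pose n := (Num.truncn (T / (h / 2))).+1.
exists (h / 2), (7 ^+ n); split; [lra|by rewrite exprn_ge0|].
move=> psi eps S sigma y z psi_close S_sub Ssigma S_gap y_ap z_ap S_sp t St.
apply: (stability_windows lip C40 four Cd0 def psi_close _ _ S_sub Ssigma S_gap) => //.
- lra.
- move=> s u su u_s; have [|_ le_e] := small s u su; first lra.
  apply: le_trans (ler_wpM2l B0 le_e) _.
  by rewrite invfM mulrCA ler_piMr ?invr_ge0 // ler_pdivrMr; lra.
- have [t0 /andP[sigma_t tT]] := S_sub _ St.
  have : T <= n%:R * (h / 2).
    by rewrite -ler_pdivrMr; [rewrite ltW // truncnS_gt | lra].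
  have [? _] := S_sub _ Ssigma; lra.
Qed.

End stability.

(** * Schemes and D-solutions near a stable almost flow *)

Section schemes.
Context {R : realType} {V : normedModType R}.
Context (T : R) (delta varpi : R -> R) (omega : R -> R -> R) (kappa M : R).
Hypothesis Hstd : standing_assumptions T delta varpi omega kappa.
Hypothesis M_ge0 : 0 <= M.
Implicit Types (phi psi : R -> R -> V -> V) (S : set R) (y z : R -> V).

Notation L := (sewing_const T delta kappa M).
Notation almost_flow := (almost_flow T delta varpi omega M).
Notation stable := (stable_almost_flow T delta varpi omega M).

Lemma modulus_small e : 0 < e -> exists2 h, 0 < h &
  forall s t, simplex2 T s t -> t <= s + h ->
    L * varpi (omega s t) + delta (t - s) <= e.
Proof.
move=> e0; have L0 := sewing_const_ge0 Hstd M_ge0.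
have e1 : 0 < e / (2 * (L + 1)) by rewrite divr_gt0 //; lra.
have [h1 h10 small1] := varpi_omega_small Hstd e1.
have [h2 h20 small2] := delta_small Hstd (divr_gt0 e0 (ltr0n R 2)).
exists (Num.min h1 h2); first by rewrite lt_min h10.
move=> s t st ts.
have [m1 m2] : Num.min h1 h2 <= h1 /\ Num.min h1 h2 <= h2.
  by rewrite !ge_min !lexx orbT.
have [|_ v1] := small1 s t st; first lra.
have v2 : delta (t - s) <= e / 2 by apply: small2; case: st => *; lra.
have : L * (e / (2 * (L + 1))) <= e / 2.
  have -> : L * (e / (2 * (L + 1))) = e / 2 * (L / (L + 1)) by field; lra.
  by apply: ler_piMr; [lra | rewrite ler_pdivrMr; lra].
have := ler_wpM2l L0 v1; lra.
Qed.

Lemma approx_solution_modulus phi S y s t : almost_flow phi ->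
  approx_solution varpi omega phi L S y -> S s -> S t -> simplex2 T s t ->
  `|y t - y s| <= L * varpi (omega s t) + delta (t - s).
Proof.
move=> phiM y_ap Ss St st.
apply: le_trans (ler_distD (phi t s (y s)) _ _) _; apply: lerD.
  by apply: y_ap => //; case: st.
by apply: (almost_flow_displacement phiM).
Qed.

Lemma scheme_interpolation_flow h p t : 0 <= h -> h <= T ->
  itv_partition 0 T p -> steps_le h 0 p -> 0 <= t <= T ->
  exists s, [/\ s \in 0 :: p, s <= t, t - s <= h &
    forall phi (x : V), almost_flow phi ->
      `|scheme phi 0 x p t - scheme phi 0 x p s| <= delta h].
Proof.
move=> h0 hT pT hp tT.
have [s [sp st ts close]] :=
  @scheme_interpolation _ V _ _ _ _ _ _ pT hp tT h0 (delta_ge0 Hstd h0).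
exists s; split=> // phi x phiM; apply: close => u u' v u0 uu' u'T u'u.
apply: le_trans (almost_flow_displacement phiM v (s := u) (t := u') _) _.
  by split=> //; lra.
by apply: (delta_homo Hstd); lra.
Qed.

Lemma increment_gap_scheme phi psi x x' s0 p k : itv_partition s0 T p ->
  (k < size p)%N ->
  increment_gap phi psi (scheme phi s0 x p) (scheme psi s0 x' p)
    (nth T (s0 :: p) k) (nth T (s0 :: p) k.+1) = 0.
Proof.
move=> s0p kp; rewrite /increment_gap (scheme_step _ _ s0p kp).
by rewrite (scheme_step _ _ s0p kp) subrr sub0r addNr.
Qed.

Lemma scheme_stability phi : stable phi ->
  exists h C, [/\ 0 < h, 0 <= C & forall psi eps s0 p x x',
    almost_flow psi -> flow_close T delta varpi omega eps phi psi ->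
    0 <= s0 -> itv_partition s0 T p -> steps_le h s0 p ->
    forall t, t \in s0 :: p ->
      `|scheme phi s0 x p t - scheme psi s0 x' p t| <= C * (`|x - x'| + eps)].
Proof.
move=> phi_stable; have phiM := stable_almost phi_stable.
have [h [C [h0 C0 stab]]] := stability Hstd M_ge0 phi_stable.
exists h, C; split=> // psi eps s0 p x x' psiM psi_close s00 s0p hp t tp.
have start_y := scheme_start phi x s0p; have start_z := scheme_start psi x' s0p.
rewrite -{2}start_y -{2}start_z.
apply: (stab psi eps [set` s0 :: p]) => //.
- by move=> u /(mem_grid_bounds s0p)/andP[s0u uT]; rewrite s0u uT; split=> //; lra.
- exact: mem_head.
- move=> u us0T.
  have [v [vp vu uv _]] := @scheme_interpolation _ V _ _ _ _ _ _ s0p hp us0T (ltW h0) ler01.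
  by exists v => //; rewrite vu; lra.
- exact: scheme_approx_solution.
- exact: scheme_approx_solution.
- apply: (splits_partition Hstd) => // k kp.
  by rewrite increment_gap_scheme ?normr0.
Qed.

(** Follow the scheme restarted from [y] at each point of the partition: passing
    from one restart to the next costs a one-step error, propagated by the
    Lipschitz bound, and these errors add up to [e * omega s0 T] by
    superadditivity. *)
Lemma scheme_telescope phi : stable phi ->
  exists h C, [/\ 0 < h, 0 <= C & forall h' e s0 p y, h' <= h -> 0 <= e ->
    0 <= s0 -> itv_partition s0 T p -> steps_le h' s0 p ->
    (forall s s', s \in s0 :: p -> s' \in s0 :: p -> s <= s' -> s' - s <= h' ->
      `|y s' - phi s' s (y s)| <= e * omega s s') ->
    forall t, t \in s0 :: p ->
      `|scheme phi s0 (y s0) p t - y t| <= C * (e * omega s0 T)].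
Proof.
move=> phi_stable; have phiM := stable_almost phi_stable.
have [h [C0 [h0 C00 stab]]] := scheme_stability phi_stable.
pose C := C0 + 1.
exists h, C; rewrite /C; split=> //; first lra.
move=> h' e s0 p y h'h e0; elim: p s0 => [|s' p IHp] s0 s00 s0p hp step t.
  rewrite inE => /eqP ->; rewrite (scheme_start _ _ s0p) subrr normr0.
  rewrite !mulr_ge0 ?addr_ge0 //; apply: (control_ge0 (omega_control Hstd)).
  by split=> //; exact: itv_partition_le s0p.
have [ss' s'p] := itv_partition_head_tail s0p; have [s's hp'] := andP hp.
have s'T := itv_partition_le s'p.
rewrite inE => /orP[/eqP ->|tp].
  rewrite (scheme_start _ _ s0p) subrr normr0.
  rewrite !mulr_ge0 ?addr_ge0 //; apply: (control_ge0 (omega_control Hstd)).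
  by split=> //; exact: itv_partition_le s0p.
have s't : s' <= t by case/andP: (mem_grid_bounds s'p tp).
rewrite (scheme_cons _ _ s0p s't).
apply: le_trans (ler_distD (scheme phi s' (y s') p t) _ _) _.
have first_err : `|y s' - phi s' s0 (y s0)| <= e * omega s0 s'.
  by apply: step; rewrite ?inE ?eqxx ?orbT // ltW.
have s'0 : 0 <= s' by lra.
have hp'' : steps_le h s' p by apply: sub_path hp' => ? ?; lra.
have lip := stab phi 0 s' p (phi s' s0 (y s0)) (y s') phiM
  (flow_closexx _ _ _ _ phi) s'0 s'p hp'' t tp.
have IH : `|scheme phi s' (y s') p t - y t| <= (C0 + 1) * (e * omega s' T).
  apply: IHp => // u u' up u'p; apply: step; by rewrite inE ?up ?u'p orbT.
have s0s'T : simplex3 T s0 s' T by split=> //; lra.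
have sup := control_superadditive (omega_control Hstd) s0s'T.
have w0 := control_ge0 (omega_control Hstd) (simplex3_12 s0s'T).
have e1 := ler_wpM2l e0 sup.
have C1 : 0 <= C0 + 1 by lra.
have e2 := ler_wpM2l C1 e1.
have e3 := ler_wpM2l C00 first_err.
have e4 := mulr_ge0 e0 w0.
rewrite addr0 (distrC (phi s' s0 (y s0))) in lip.
lra.
Qed.

(** Two schemes are compared, at the last points [s] and [s'] of their partitions
    before [t], with the scheme on the common refinement, whose increment between
    [s] and [s'] is small. *)
Lemma stable_schemes_cauchy phi e : stable phi -> 0 < e ->
  exists2 h, 0 < h & forall x p q, itv_partition 0 T p -> itv_partition 0 T q ->
    steps_le h 0 p -> steps_le h 0 q ->
    forall t, 0 <= t <= T -> `|scheme phi 0 x p t - scheme phi 0 x q t| <= e.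
Proof.
move=> phi_stable e0; have phiM := stable_almost phi_stable.
have T0 := T_gt0 Hstd.
have L0 := sewing_const_ge0 Hstd M_ge0.
have w0 : 0 <= omega 0 T by apply: (control_ge0 (omega_control Hstd)); split; lra.
have [h1 [C [h10 C0 tele]]] := scheme_telescope phi_stable.
have [h2 h20 modulus] := modulus_small (ltac:(lra) : 0 < e / 4).
have [h3 h30 d_small] := delta_small Hstd (ltac:(lra) : 0 < e / 4).
have CLw := mulr_ge0 (mulr_ge0 C0 L0) w0.
pose e1 := e / (8 * (C * L * omega 0 T + 1)).
have e10 : 0 < e1 by rewrite divr_gt0 //; lra.
have CLe : C * (L * e1 * omega 0 T) <= e / 8.
  have -> : C * (L * e1 * omega 0 T) = (e / 8) * (C * L * omega 0 T / (C * L * omega 0 T + 1)).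
    by rewrite /e1; field; lra.
  by apply: ler_piMr; [lra | rewrite ler_pdivrMr; lra].
have [h4 h40 v_small] := varpi_omega_small Hstd e10.
pose h := Num.min (Num.min (Num.min h1 h2) (Num.min h3 h4)) T.
have [hh1 [hh2 [hh3 [hh4 hhT]]]] : h <= h1 /\ h <= h2 /\ h <= h3 /\ h <= h4 /\ h <= T.
  by rewrite /h !ge_min !lexx !orbT.
have h0 : 0 < h by rewrite !lt_min h10 h20 h30 h40.
exists h => // x p q pT qT hp hq t tT.
have rT := refinement_partition pT qT.
pose r := refinement p q.
have r_ap := scheme_approx_solution Hstd M_ge0 phiM x (lexx 0) rT.
have dh : delta h <= e / 4 by apply: d_small; lra.
have coarse u s : itv_partition 0 T u -> steps_le h 0 u ->
    {subset 0 :: u <= 0 :: r} -> s \in 0 :: u ->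
    `|scheme phi 0 x u s - scheme phi 0 x r s| <= e / 8.
  move=> uT hu ur su; apply: le_trans CLe.
  rewrite -{1}(scheme_start phi x rT).
  apply: (tele h _ _ _ (scheme phi 0 x r)) => //; first by rewrite mulr_ge0 // ltW.
  move=> v v' vu v'u vv' v'v.
  apply: le_trans (r_ap _ _ (ur _ vu) (ur _ v'u) vv') _.
  rewrite -[leRHS]mulrA; apply: ler_wpM2l => //.
  have vb := mem_grid_bounds uT vu; have v'b := mem_grid_bounds uT v'u.
  have vv : simplex2 T v v' by split; lra.
  by have [|] := v_small v v' vv; first by lra.
have [s [sp st ts sclose]] := scheme_interpolation_flow (ltW h0) hhT pT hp tT.
have [s' [s'q s't ts' s'close]] := scheme_interpolation_flow (ltW h0) hhT qT hq tT.
have pr : {subset 0 :: p <= 0 :: r} by move=> v vp; apply: mem_refinement; left.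
have qr : {subset 0 :: q <= 0 :: r} by move=> v vq; apply: mem_refinement; right.
have middle : `|scheme phi 0 x r s - scheme phi 0 x r s'| <= e / 4.
  have sb := mem_grid_bounds pT sp; have s'b := mem_grid_bounds qT s'q.
  have [ss'|s's] := leP s s'; [rewrite distrC|].
  - have ss : simplex2 T s s' by split; lra.
    apply: le_trans (approx_solution_modulus phiM r_ap (pr _ sp) (qr _ s'q) ss) _.
    by apply: modulus => //; lra.
  - have ss : simplex2 T s' s by split; lra.
    apply: le_trans (approx_solution_modulus phiM r_ap (qr _ s'q) (pr _ sp) ss) _.
    by apply: modulus => //; lra.
have a1 := sclose phi x phiM; have a2 := coarse p s pT hp pr sp.
have a3 := coarse q s' qT hq qr s'q; have a4 := s'close phi x phiM.
have := ler_distD (scheme phi 0 x p s) (scheme phi 0 x p t) (scheme phi 0 x q t).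
have := ler_distD (scheme phi 0 x r s) (scheme phi 0 x p s) (scheme phi 0 x q t).
have := ler_distD (scheme phi 0 x r s') (scheme phi 0 x r s) (scheme phi 0 x q t).
have := ler_distD (scheme phi 0 x q s') (scheme phi 0 x r s') (scheme phi 0 x q t).
rewrite (distrC (scheme phi 0 x q s') (scheme phi 0 x q t)).
rewrite (distrC (scheme phi 0 x r s') (scheme phi 0 x q s')).
lra.
Qed.

(** Each scheme of [psi] is close, on the same partition, to that of the stable
    flow [phi], and the latter are close to one another. *)
Lemma nearby_schemes_cauchy phi e : stable phi -> 0 < e ->
  exists eta h, [/\ 0 < eta, 0 < h & forall psi x x' p q,
    almost_flow psi -> flow_close T delta varpi omega eta phi psi ->
    `|x - x'| <= eta ->
    itv_partition 0 T p -> itv_partition 0 T q ->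
    steps_le h 0 p -> steps_le h 0 q ->
    forall t, 0 <= t <= T -> `|scheme psi 0 x' p t - scheme psi 0 x' q t| <= e].
Proof.
move=> phi_stable e0; have phiM := stable_almost phi_stable.
have T0 := T_gt0 Hstd.
have [h1 h10 cauchy] := stable_schemes_cauchy phi_stable (ltac:(lra) : 0 < e / 3).
have [h2 [C [h20 C0 stab]]] := scheme_stability phi_stable.
have [h3 h30 d_small] := delta_small Hstd (ltac:(lra) : 0 < e / 12).
pose h := Num.min (Num.min h1 h2) (Num.min h3 T).
have [hh1 [hh2 [hh3 hhT]]] : h <= h1 /\ h <= h2 /\ h <= h3 /\ h <= T.
  by rewrite /h !ge_min !lexx !orbT.
have h0 : 0 < h by rewrite !lt_min h10 h20 h30.
have eta0 : 0 < e / (12 * (C + 1)) by rewrite divr_gt0 //; lra.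
exists (e / (12 * (C + 1))), h; split=> // psi x x' p q psiM psi_close xx' pT qT hp hq t tT.
set eta := e / _ in eta0 psi_close xx'.
have Ceta : C * (eta + eta) <= e / 6.
  have -> : C * (eta + eta) = e / 6 * (C / (C + 1)) by rewrite /eta; field; lra.
  by apply: ler_piMr; [lra | rewrite ler_pdivrMr; lra].
have dh : delta h <= e / 12 by apply: d_small; lra.
have compare u : itv_partition 0 T u -> steps_le h 0 u ->
    `|scheme phi 0 x u t - scheme psi 0 x' u t| <= e / 3.
  move=> uT hu.
  have [s [su st ts close]] := scheme_interpolation_flow (ltW h0) hhT uT hu tT.
  have hu2 : steps_le h2 0 u by apply: sub_path hu => ? ?; lra.
  have := stab psi eta 0 u x x' psiM psi_close (lexx 0) uT hu2 s su.
  have : C * (`|x - x'| + eta) <= C * (eta + eta) by rewrite ler_wpM2l // lerD2r.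
  have := close phi x phiM; have := close psi x' psiM.
  have := ler_distD (scheme phi 0 x u s) (scheme phi 0 x u t) (scheme psi 0 x' u t).
  have := ler_distD (scheme psi 0 x' u s) (scheme phi 0 x u s) (scheme psi 0 x' u t).
  rewrite (distrC (scheme psi 0 x' u s) (scheme psi 0 x' u t)).
  lra.
have mono u : steps_le h 0 u -> steps_le h1 0 u by apply: sub_path => ? ?; lra.
have := cauchy x p q pT qT (mono _ hp) (mono _ hq) t tT.
have := compare p pT hp; have := compare q qT hq.
have := ler_distD (scheme phi 0 x p t) (scheme psi 0 x' p t) (scheme psi 0 x' q t).
have := ler_distD (scheme phi 0 x q t) (scheme phi 0 x p t) (scheme psi 0 x' q t).
rewrite (distrC (scheme psi 0 x' p t) (scheme phi 0 x p t)).
lra.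
Qed.

(** Every D-solution of [psi] is close to one and the same D-solution of [phi]. *)
Lemma nearby_D_solutions phi e : stable phi -> 0 < e ->
  (forall x, exists y, D_solution T varpi omega phi x y) ->
  exists2 eta, 0 < eta & forall psi x x' z z',
    almost_flow psi -> flow_close T delta varpi omega eta phi psi ->
    `|x - x'| <= eta ->
    D_solution T varpi omega psi x' z -> D_solution T varpi omega psi x' z' ->
    forall t, 0 <= t <= T -> `|z t - z' t| <= e.
Proof.
move=> phi_stable e0 exists_y; have phiM := stable_almost phi_stable.
have T0 := T_gt0 Hstd; have L0 := sewing_const_ge0 Hstd M_ge0.
have [h [C [h0 C0 stab]]] := stability Hstd M_ge0 phi_stable.
have eta0 : 0 < e / (4 * (C + 1)) by rewrite divr_gt0 //; lra.
exists (e / (4 * (C + 1))) => // psi x x' z z' psiM psi_close xx' z_sol z'_sol t tT.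
set eta := e / _ in eta0 psi_close xx'.
have Ceta : C * (eta + eta) <= e / 2.
  have -> : C * (eta + eta) = e / 2 * (C / (C + 1)) by rewrite /eta; field; lra.
  by apply: ler_piMr; [lra | rewrite ler_pdivrMr; lra].
have [y y_sol] := exists_y x.
have y_ap := D_solution_approx Hstd M_ge0 phiM y_sol.
have compare v : D_solution T varpi omega psi x' v -> `|y t - v t| <= e / 2.
  move=> v_sol; have v_ap := D_solution_approx Hstd M_ge0 psiM v_sol.
  have y0 : y 0 = x by case: y_sol.
  have v0 : v 0 = x' by case: v_sol.
  apply: (@le_trans _ _ (C * (`|y 0 - v 0| + eta))); last first.
    by rewrite y0 v0; apply: le_trans Ceta; rewrite ler_wpM2l // lerD2r.
  apply: (stab psi eta `[0, T]%classic 0 y v) => //.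
  - by move=> u; rewrite /= in_itv /= => /andP[-> ->].
  - by rewrite /= in_itv /= lexx ltW.
  - by move=> u uT; exists u; rewrite /= ?in_itv //; lra.
  - apply: (splits_interval Hstd (K := 2 * L)); first lra.
    move=> r s rs; have [r0 rs' sT] := rs.
    have ri : `[0, T]%classic r by rewrite /= in_itv /=; lra.
    have si : `[0, T]%classic s by rewrite /= in_itv /=; lra.
    exact: gap_rough y_ap v_ap _ _ ri si rs'.
have := compare z z_sol; have := compare z' z'_sol.
have := ler_distD (y t) (z t) (z' t); rewrite (distrC (z t) (y t)); lra.
Qed.

End schemes.

(** * Limits of schemes *)

Section limits.
Context {R : realType} {V : completeNormedModType R}.
Context (T : R) (delta varpi : R -> R) (omega : R -> R -> R) (kappa M : R).
Hypothesis Hstd : standing_assumptions T delta varpi omega kappa.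
Hypothesis M_ge0 : 0 <= M.
Implicit Types (phi psi : R -> R -> V -> V) (y z : R -> V).

Notation L := (sewing_const T delta kappa M).
Notation almost_flow := (almost_flow T delta varpi omega M).
Notation stable := (stable_almost_flow T delta varpi omega M).

(** Schemes satisfy the inequality with the constant [sewing_const] between any
    two points of their partition, and [phi t s] is continuous. *)
Lemma schemes_limit_D_solution phi x y : almost_flow phi ->
  {within `[0, T], continuous y} -> schemes_converge T phi x y ->
  D_solution T varpi omega phi x y.
Proof.
move=> phiM y_cont y_lim; have T0 := T_gt0 Hstd.
have L0 := sewing_const_ge0 Hstd M_ge0.
have approx e s t : 0 < e -> simplex2 T s t -> exists p,
    [/\ itv_partition 0 T p, s \in 0 :: p, t \in 0 :: p,
      `|scheme phi 0 x p s - y s| <= e & `|scheme phi 0 x p t - y t| <= e].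
  move=> e0 [s0 st tT]; have [p0 p0T close] := y_lim e e0.
  have [p [pT pm sp tp]] := exists_fine_partition_through (mesh_gt0 T0 p0T) s0 st tT.
  have m : mesh p <= mesh p0 by rewrite mesh_le // ltW // (mesh_gt0 T0 p0T).
  by exists p; split=> //; apply: close => //; rewrite in_itv /=; lra.
split=> //.
  apply/eqP; rewrite -subr_eq0 -normr_le0; apply/ler_addgt0Pr => e e0.
  have [|p [pT _ _ + _]] := approx e 0 0 e0; first by split; lra.
  by rewrite (scheme_start _ _ pT) distrC add0r.
exists L => // s t st; apply/ler_addgt0Pr => e e0.
have e20 : 0 < e / 2 by lra.
have : phi t s @ y s --> phi t s (y s) by exact: (almost_flow_continuous phiM st).
move=> /cvgrPdist_le/(_ _ e20)/nbhs_ballP[d /= d0 phi_close].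
have m0 : 0 < Num.min (d / 2) (e / 2) by rewrite lt_min; lra.
have [p [pT sp tp ys yt]] := approx _ s t m0 st.
have [m1 m2] : Num.min (d / 2) (e / 2) <= d / 2 /\ Num.min (d / 2) (e / 2) <= e / 2.
  by rewrite !ge_min !lexx orbT.
have le_st : s <= t by case: st.
have p_ap := scheme_approx_solution Hstd M_ge0 phiM x (lexx 0) pT sp tp le_st.
have ball_s : ball (y s) d (scheme phi 0 x p s).
  by rewrite -ball_normE /= distrC; lra.
have := phi_close _ ball_s => /= phi_s.
have := ler_distD (scheme phi 0 x p t) (y t) (phi t s (y s)).
have := ler_distD (phi t s (scheme phi 0 x p s)) (scheme phi 0 x p t) (phi t s (y s)).
rewrite (distrC (y t) (scheme _ _ _ _ _)) (distrC (phi t s (scheme phi 0 x p s)) (phi t s (y s))).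
lra.
Qed.

Definition schemes_within phi x (e : R) : Prop :=
  exists2 h, 0 < h & forall p q, itv_partition 0 T p -> itv_partition 0 T q ->
    steps_le h 0 p -> steps_le h 0 q ->
    forall t, 0 <= t <= T -> `|scheme phi 0 x p t - scheme phi 0 x q t| <= e.

Lemma scheme_modulus phi x : almost_flow phi -> forall e, 0 < e ->
  exists2 h, 0 < h & forall p, itv_partition 0 T p -> steps_le h 0 p ->
    forall s t, 0 <= s -> s <= t -> t <= T -> t - s <= h ->
      `|scheme phi 0 x p t - scheme phi 0 x p s| <= e.
Proof.
move=> phiM e e0; have T0 := T_gt0 Hstd.
have [h1 h10 modulus] := modulus_small Hstd M_ge0 (ltac:(lra) : 0 < e / 3).
have [h2 h20 d_small] := delta_small Hstd (ltac:(lra) : 0 < e / 3).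
pose h := Num.min (h1 / 2) (Num.min h2 T).
have [hh1 [hh2 hhT]] : h <= h1 / 2 /\ h <= h2 /\ h <= T.
  by rewrite /h !ge_min !lexx !orbT.
have h0 : 0 < h by rewrite !lt_min h20 T0 !andbT divr_gt0.
exists h => // p pT hp s t s0 st tT ts.
have sT : 0 <= s <= T by lra.
have tT' : 0 <= t <= T by lra.
have [s1 [s1p s1s s1h s1close]] := scheme_interpolation_flow (V := V) M Hstd (ltW h0) hhT pT hp sT.
have [t1 [t1p t1t t1h t1close]] := scheme_interpolation_flow (V := V) M Hstd (ltW h0) hhT pT hp tT'.
have dh : delta h <= e / 3 by apply: d_small; lra.
have p_ap := scheme_approx_solution Hstd M_ge0 phiM x (lexx 0) pT.
have middle : `|scheme phi 0 x p t1 - scheme phi 0 x p s1| <= e / 3.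
  have s1b := mem_grid_bounds pT s1p; have t1b := mem_grid_bounds pT t1p.
  have [st1|ts1] := leP s1 t1; [|rewrite distrC].
  - have ss : simplex2 T s1 t1 by split; lra.
    apply: le_trans (approx_solution_modulus phiM p_ap s1p t1p ss) _.
    by apply: modulus => //; lra.
  - have ss : simplex2 T t1 s1 by split; lra.
    apply: le_trans (approx_solution_modulus phiM p_ap t1p s1p ss) _.
    by apply: modulus => //; lra.
have a1 := s1close phi x phiM; have a2 := t1close phi x phiM.
have := ler_distD (scheme phi 0 x p t1) (scheme phi 0 x p t) (scheme phi 0 x p s).
have := ler_distD (scheme phi 0 x p s1) (scheme phi 0 x p t1) (scheme phi 0 x p s).
rewrite (distrC (scheme phi 0 x p s1) (scheme phi 0 x p s)).
lra.
Qed.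

(** The limit is taken along one sequence of partitions; it inherits its
    continuity from the common modulus of the schemes. *)
Lemma cauchy_schemes_converge phi x : almost_flow phi ->
  (forall e, 0 < e -> schemes_within phi x e) ->
  exists2 y, {within `[0, T], continuous y} & schemes_converge T phi x y.
Proof.
move=> phiM cauchy; have T0 := T_gt0 Hstd.
have [tol [tol0 anti tol_small]] := @null_sequence R.
have /choice[P PP] : forall n, exists p, itv_partition 0 T p /\
    forall q, itv_partition 0 T q -> mesh q <= mesh p ->
    forall t, 0 <= t <= T -> `|scheme phi 0 x p t - scheme phi 0 x q t| <= tol n.
  move=> n; have [h h0 close] := cauchy _ (tol0 n).
  have [p pT hp] := exists_fine_partition h0 T0.
  exists p; split=> // q qT qp; apply: close => //.
  by rewrite -(mesh_le q (ltW h0)) (le_trans qp) // mesh_le // ltW.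
have close2 n m t : 0 <= t <= T ->
    `|scheme phi 0 x (P n) t - scheme phi 0 x (P m) t| <= tol n + tol m.
  move=> tT; have [nT nclose] := PP n; have [mT mclose] := PP m.
  have mn0 : 0 < Num.min (mesh (P n)) (mesh (P m)).
    by rewrite lt_min !(mesh_gt0 T0).
  have [q qT hq] := exists_fine_partition mn0 T0.
  have qm : mesh q <= Num.min (mesh (P n)) (mesh (P m)) by rewrite mesh_le // ltW.
  move: qm; rewrite le_min => /andP[qn qm].
  have := nclose q qT qn t tT; have := mclose q qT qm t tT.
  have := ler_distD (scheme phi 0 x q t) (scheme phi 0 x (P n) t) (scheme phi 0 x (P m) t).
  rewrite (distrC (scheme phi 0 x q t) (scheme phi 0 x (P m) t)); lra.
have cvg_t t : 0 <= t <= T -> cvgn (fun n => scheme phi 0 x (P n) t).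
  move=> tT; apply/cauchy_cvgP/cauchy_exP => e e0.
  have [n ne] := tol_small (e / 4) (ltac:(lra)).
  exists (scheme phi 0 x (P n) t), n => // m /= nm; rewrite -ball_normE /=.
  have := close2 n m t tT; have := anti _ _ nm; lra.
pose y t := limn (fun n => scheme phi 0 x (P n) t).
have y_close n t : 0 <= t <= T -> `|scheme phi 0 x (P n) t - y t| <= tol n.
  move=> tT; apply/ler_addgt0Pr => e e0.
  have e20 : 0 < e / 2 by lra.
  have /cvgrPdist_le/(_ _ e20) : (fun m => scheme phi 0 x (P m) t) @ \oo --> y t.
    exact: cvg_t.
  have [k ke] := tol_small _ e20.
  move=> [N _ NP].
  have := NP (maxn N k) (leq_maxl _ _) => /=.
  have := close2 n (maxn N k) t tT; have := anti _ _ (leq_maxr N k).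
  set w := scheme phi 0 x (P (maxn N k)) t; rewrite (distrC (y t) w).
  have := ler_distD w (scheme phi 0 x (P n) t) (y t); lra.
have y_lim : schemes_converge T phi x y.
  move=> e e0; have [n ne] := tol_small (e / 2) (ltac:(lra)).
  have [nT nclose] := PP n; exists (P n) => // q qT qn t; rewrite in_itv /= => tT.
  have := nclose q qT qn t tT; have := y_close n t tT.
  have := ler_distD (scheme phi 0 x (P n) t) (scheme phi 0 x q t) (y t).
  rewrite (distrC (scheme phi 0 x q t) (scheme phi 0 x (P n) t)); lra.
exists y => //.
have y_unif e : 0 < e -> exists2 h, 0 < h & forall s t, 0 <= s -> s <= t -> t <= T ->
    t - s <= h -> `|y t - y s| <= e.
  move=> e0; have e30 : 0 < e / 3 by lra.
  have [h h0 unif] := scheme_modulus x phiM e30.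
  have [p0 p0T close] := y_lim _ e30.
  have m0 : 0 < Num.min h (mesh p0) by rewrite lt_min h0 (mesh_gt0 T0).
  have [p pT hp] := exists_fine_partition m0 T0.
  have : mesh p <= Num.min h (mesh p0) by rewrite mesh_le // ltW.
  rewrite le_min => /andP[ph pp0].
  have steps_p : steps_le h 0 p by rewrite -(mesh_le p (ltW h0)).
  exists h => // s t s0 st tT ts.
  have sI : s \in `[0, T] by rewrite in_itv /=; lra.
  have tI : t \in `[0, T] by rewrite in_itv /=; lra.
  have := close p pT pp0 s sI; have := close p pT pp0 t tI.
  have := unif p pT steps_p s t s0 st tT ts.
  have := ler_distD (scheme phi 0 x p t) (y t) (y s).
  have := ler_distD (scheme phi 0 x p s) (scheme phi 0 x p t) (y s).
  rewrite (distrC (y t) (scheme _ _ _ _ _)); lra.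
apply/subspace_continuousP => t; rewrite /= in_itv /= => /andP[t0 tT].
apply/cvgrPdist_le => e e0; have [h h0 unif] := y_unif e e0.
rewrite near_withinE; apply/nbhs_ballP; exists h => //= s.
rewrite -ball_normE /= in_itv /= => ts /andP[s0 sT].
move: ts; have [st|/ltW ts] := leP s t => hts.
  by apply: unif => //; move: hts; rewrite ger0_norm; lra.
by rewrite distrC; apply: unif => //; move: hts; rewrite distrC ger0_norm; lra.
Qed.

End limits.

(** * Genericity *)

Theorem theorem1 (R : realType) (V : completeNormedModType R)
    (T : R) (delta varpi : R -> R) (omega : R -> R -> R) (kappa M : R)
    (Hstd : standing_assumptions T delta varpi omega kappa) (HM : 0 <= M)
    (Q : metricType R) (Qcomplete : complete_space Q)
    (Rs : set Q) (Rs_dense : dense Rs)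
    (phi : Q -> R -> R -> V -> V)
    (phi_almost : forall f, almost_flow T delta varpi omega M (phi f))
    (phi_continuous : forall (f : Q) (e : R), 0 < e ->
      \forall g \near f, (d_A T delta varpi omega (phi f) (phi g) < e%:E)%E)
    (phi_stable : forall f, Rs f ->
      stable_almost_flow T delta varpi omega M (phi f)) :
  let N : set (V * Q) := [set af | exists2 y : R -> V,
    {within `[0, T], continuous y} &
    schemes_converge T (phi af.2) af.1 y] in
  [/\ residual N,
      forall (a : V) (f : Q) (y : R -> V), N (a, f) ->
        {within `[0, T], continuous y} ->
        schemes_converge T (phi f) a y ->
        D_solution T varpi omega (phi f) a y &
      residual [set af : V * Q |
        unique_D_solution T varpi omega (phi af.2) af.1]].
Proof.
move=> N.
have [tol [tol0 _ tol_small]] := @null_sequence R.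
pose G (n : nat) : set (V * Q) := [set af |
  schemes_within T (phi af.2) af.1 (tol n) /\
  forall z z', D_solution T varpi omega (phi af.2) af.1 z ->
    D_solution T varpi omega (phi af.2) af.1 z' ->
    forall t, 0 <= t <= T -> `|z t - z' t| <= tol n].
have limit_sol a f y : {within `[0, T], continuous y} ->
    schemes_converge T (phi f) a y -> D_solution T varpi omega (phi f) a y.
  exact: (schemes_limit_D_solution Hstd HM).
have G_near n a f : Rs f -> (G n)° (a, f).
  move=> Rf; have f_stable := phi_stable f Rf.
  have [eta1 [h [eta10 h0 near1]]] := nearby_schemes_cauchy Hstd HM f_stable (tol0 n).
  have exists_y x : exists y, D_solution T varpi omega (phi f) x y.
    have [|y yc ylim] := @cauchy_schemes_converge _ _ _ _ _ _ _ _ Hstd HM (phi f) x (phi_almost f).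
      move=> e e0; have [h' h'0 close] := stable_schemes_cauchy Hstd HM f_stable e0.
      by exists h' => // p q pT qT hp hq; exact: close.
    by exists y; exact: limit_sol.
  have [eta2 eta20 near2] := nearby_D_solutions Hstd HM f_stable (tol0 n) exists_y.
  pose eta := Num.min eta1 eta2.
  have eta0 : 0 < eta by rewrite lt_min eta10.
  have [eta_1 eta_2] : eta <= eta1 /\ eta <= eta2 by rewrite !ge_min !lexx orbT.
  exists (ball a eta, [set g | (d_A T delta varpi omega (phi f) (phi g) < eta%:E)%E]).
    by split; [exact: nbhsx_ballx | exact: phi_continuous].
  move=> [b g] /= []; rewrite -ball_normE /= => ab fg.
  have closeness eta' : 0 < eta' -> eta <= eta' ->
      flow_close T delta varpi omega eta' (phi f) (phi g).
    move=> eta'0 le_eta; apply: (d_A_close Hstd (phi_almost f) (phi_almost g) (ltW eta'0)).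
    by apply: le_trans (ltW fg) _; rewrite lee_fin.
  split.
    exists h => // p q pT qT hp hq.
    by apply: (near1 (phi g) a b) => //; [exact: closeness | lra].
  move=> z z'; apply: (near2 (phi g) a b) => //; [exact: closeness | lra].
have G_dense n : dense (G n)°.
  move=> O [[a f] Oaf] O_open.
  have [[A B] /= [Aa Bf] AB] := open_nbhs_nbhs (conj O_open Oaf).
  have [g [Bg Rg]] := Rs_dense B° (ex_intro _ f Bf) (open_interior B).
  exists (a, g); split; last exact: G_near.
  by apply: AB; split; [exact: nbhs_singleton | exact: interior_subset Bg].
have G_N : \bigcap_n G n `<=` N.
  move=> [a f] aG; apply: (cauchy_schemes_converge Hstd HM (phi_almost f)) => e e0.
  have [n ne] := tol_small e e0; have [[h h0 close] _] := aG n I.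
  exists h => // p q pT qT hp hq t tT; exact: le_trans (close p q pT qT hp hq t tT) ne.
split.
- exact: residual_bigcap G_dense G_N.
- by move=> a f y _; exact: limit_sol.
- apply: residual_bigcap G_dense _ => -[a f] aG.
  have [y yc ylim] := G_N _ aG.
  have y_sol := limit_sol a f y yc ylim.
  exists y => // z z_sol t; rewrite in_itv /= => tT.
  apply/eqP; rewrite -subr_eq0 -normr_le0; apply/ler_addgt0Pr => e e0.
  rewrite add0r; have [n ne] := tol_small e e0; have [_ G_uniq] := aG n I.
  exact: le_trans (G_uniq _ _ z_sol y_sol t tT) ne.
Qed.
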